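(* For $x \in \mathbb{R}_+ = (0,\infty)$, define $$\psi_1(x) = x^{3/4}\,\theta_1^+(x).$$ Then for all $x\in\mathbb{R}_+$ $$\psi_1(x) = x^{3/4}\prod_{j=2}^4\theta_j(x) = 2\,x^{3/4}\,e^{-\frac{\pi}{4}x}\prod_{k\in\mathbb{N}}\left(1-e^{-2k\pi x}\right)^3 .$$ The function $\psi_1$ is positive on $\mathbb{R}_+$, it assumes its global maximum only at $x=1$, and the function $x\mapsto x\,\frac{\psi_1'(x)}{\psi_1(x)}$ is strictly decreasing on $\mathbb{R}_+$. Furthermore, $$\psi_1(x) = \psi_1\left(\tfrac1x\right)\qquad\text{for all } x\in\mathbb{R}_+,$$ and hence, writing $D = x\frac{d}{dx}$, $$(D^n\psi_1)(x) = (-1)^n\,(D^n\psi_1)\left(\tfrac1x\right)\qquad\text{for all } x\in\mathbb{R}_+,\ n\in\mathbb{N}.$$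
   Context: $\mathbb{N} = \{1,2,3,\dots\}$. For $x\in\mathbb{R}_+$ the functions involved are $$\theta_1^+(x) = \sum_{k\in\mathbb{Z}}(-1)^k(2k+1)\,e^{-\pi(k+1/2)^2x},$$ $$\theta_2(x) = \sum_{k\in\mathbb{Z}}e^{-\pi(k-1/2)^2x},\qquad \theta_3(x) = \sum_{k\in\mathbb{Z}}e^{-\pi k^2x},\qquad \theta_4(x) = \sum_{k\in\mathbb{Z}}(-1)^k e^{-\pi k^2x}.$$ For a smooth function $f$ on $\mathbb{R}_+$, $(Df)(x) = x f'(x)$ and $D^n$ is the $n$-fold iterate of $D$; $(D^nf)(1/x)$ denotes the value of the function $D^nf$ at the point $1/x$. *)

(* Defs.v *)
From Stdlib Require Import Reals ZArith Lia Lra.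
From Coquelicot Require Import Coquelicot.
Open Scope R_scope.

(** Two-sided series, split as [k >= 0] and [k <= -1].  [Series] is total, so
    this is the mathematical sum only when [ex_zseries a] holds; the lemmas
    below establish absolute convergence for all the series used here. *)
Definition zseries (a : Z -> R) : R :=
  Series (fun n : nat => a (Z.of_nat n)) +
  Series (fun n : nat => a (- Z.of_nat (S n))%Z).

Definition ex_zseries (a : Z -> R) : Prop :=
  ex_series (fun n : nat => a (Z.of_nat n)) /\
  ex_series (fun n : nat => a (- Z.of_nat (S n))%Z).

(** Product over [k >= 1]; note that [prod_f_R0 f N] has the [N + 1] factors
    [f 0, ..., f N]. *)
Definition partial_prod (a : nat -> R) (N : nat) : R :=
  prod_f_R0 (fun n => a (S n)) N.

Definition infprod (a : nat -> R) : R := real (Lim_seq (partial_prod a)).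

Definition theta1p_term (x : R) (k : Z) : R :=
  powerRZ (-1) k * (2 * IZR k + 1) * exp (- PI * (IZR k + 1 / 2) ^ 2 * x).
Definition theta2_term (x : R) (k : Z) : R :=
  exp (- PI * (IZR k - 1 / 2) ^ 2 * x).
Definition theta3_term (x : R) (k : Z) : R :=
  exp (- PI * IZR k ^ 2 * x).
Definition theta4_term (x : R) (k : Z) : R :=
  powerRZ (-1) k * exp (- PI * IZR k ^ 2 * x).

Definition theta1p (x : R) : R := zseries (theta1p_term x).
Definition theta2 (x : R) : R := zseries (theta2_term x).
Definition theta3 (x : R) : R := zseries (theta3_term x).
Definition theta4 (x : R) : R := zseries (theta4_term x).

Definition psi1 (x : R) : R := Rpower x (3 / 4) * theta1p x.

Definition D (f : R -> R) : R -> R := fun x => x * Derive f x.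

Definition Diter (n : nat) (f : R -> R) : R -> R := Nat.iter n D f.

Definition smooth_on_Rplus (f : R -> R) : Prop :=
  forall (n : nat) (x : R), 0 < x -> ex_derive_n f n x.

Lemma Rabs_powerRZ_m1 (k : Z) : Rabs (powerRZ (-1) k) = 1.
Proof.
  destruct k; simpl; rewrite ?Rabs_inv, ?pow_1_abs, ?Rinv_1; auto using Rabs_R1.
Qed.

Lemma exp_incr_le (x y : R) : x <= y -> exp x <= exp y.
Proof.
  intros [H|H]; [apply Rlt_le, exp_increasing, H|rewrite H; apply Rle_refl].
Qed.

Lemma gauss_bound (c y : R) :
  0 < c -> (1 + 2 * Rabs y) * exp (- c * y ^ 2)
           <= exp c * (1 + 4 / c) * exp (- (c / 2) * Rabs y).
Proof.
  intros Hc. rewrite <- (pow2_abs y). generalize (Rabs_pos y).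
  generalize (Rabs y). clear y. intros y Hy.
  assert (H1 : exp (- c * y ^ 2)
               <= exp c * exp (- (c / 2) * y) * exp (- (c / 2) * y)).
  { rewrite <- !exp_plus. apply exp_incr_le.
    assert (0 <= c * (y ^ 2 - y + 1)) by (apply Rmult_le_pos; nra). nra. }
  assert (H2 : (1 + 2 * y) * exp (- (c / 2) * y) <= 1 + 4 / c).
  { assert (H3 := exp_ineq1_le (c / 2 * y)).
    assert (H4 : exp (- (c / 2) * y) * exp (c / 2 * y) = 1).
    { rewrite <- exp_plus. replace (_ + _) with 0 by ring. apply exp_0. }
    assert (H5 := exp_pos (- (c / 2) * y)).
    assert (H6 : 0 <= c / 2 * y) by (apply Rmult_le_pos; lra).
    assert (H7 : 0 < 4 / c) by (apply Rdiv_lt_0_compat; lra).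
    assert (H8 : 1 + 2 * y <= (1 + 4 / c) * exp (c / 2 * y)).
    { apply Rle_trans with ((1 + 4 / c) * (1 + c / 2 * y)).
      - replace ((1 + 4 / c) * (1 + c / 2 * y))
          with (1 + c / 2 * y + 4 / c + 2 * y) by (field; lra).
        lra.
      - apply Rmult_le_compat_l; lra. }
    apply (Rmult_le_compat_r _ _ _ (Rlt_le _ _ H5)) in H8.
    rewrite Rmult_assoc, (Rmult_comm (exp (c / 2 * y))), H4 in H8. lra. }
  apply Rle_trans with ((1 + 2 * y)
    * (exp c * exp (- (c / 2) * y) * exp (- (c / 2) * y))).
  - apply Rmult_le_compat_l; lra.
  - assert (H9 := exp_pos c). assert (H5 := exp_pos (- (c / 2) * y)).
    assert (H10 : 0 < exp c * exp (- (c / 2) * y)) by nra.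
    apply (Rmult_le_compat_l _ _ _ (Rlt_le _ _ H10)) in H2. nra.
Qed.

Lemma ex_zseries_gauss (a : Z -> R) (c s : R) :
  0 < c ->
  (forall k, Rabs (a k) <= (1 + 2 * Rabs (IZR k + s)) * exp (- c * (IZR k + s) ^ 2)) ->
  ex_zseries (fun k => Rabs (a k)).
Proof.
  intros Hc Ha.
  set (q := exp (- (c / 2))).
  assert (Hq : Rabs q < 1).
  { unfold q. rewrite Rabs_pos_eq by apply Rlt_le, exp_pos.
    rewrite <- exp_0. apply exp_increasing. lra. }
  assert (Hmain : forall z : nat -> Z,
    (forall n, INR n <= Rabs (IZR (z n))) ->
    ex_series (fun n => Rabs (a (z n)))).
  { intros z Hz.
    apply (@ex_series_le R_AbsRing R_CompleteNormedModule) with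
      (fun n => exp c * (1 + 4 / c) * exp (c / 2 * Rabs s) * q ^ n).
    - intros n. unfold norm; simpl; unfold abs; simpl. rewrite Rabs_Rabsolu.
      eapply Rle_trans; [apply Ha|].
      eapply Rle_trans; [apply gauss_bound, Hc|].
      rewrite (Rmult_assoc (exp c * _)). apply Rmult_le_compat_l.
      + assert (0 < 4 / c) by (apply Rdiv_lt_0_compat; lra).
        assert (H' := exp_pos c). nra.
      + unfold q. rewrite <- Rpower_pow by apply exp_pos. unfold Rpower.
        rewrite ln_exp, <- exp_plus. apply exp_incr_le.
        assert (H := Rabs_triang (IZR (z n) + s) (- s)).
        replace (IZR (z n) + s + - s) with (IZR (z n)) in H by ring.
        rewrite Rabs_Ropp in H. specialize (Hz n). nra.
    - apply (@ex_series_scal R_AbsRing). apply ex_series_geom, Hq. }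
  split; apply Hmain; intros n.
  - rewrite <- INR_IZR_INZ. apply Rle_abs.
  - rewrite opp_IZR, Rabs_Ropp, <- INR_IZR_INZ.
    eapply Rle_trans; [|apply Rle_abs]. apply le_INR. lia.
Qed.

Lemma theta1p_cv (x : R) (hx : 0 < x) :
  ex_zseries (fun k => Rabs (theta1p_term x k)).
Proof.
  assert (Hp := PI_RGT_0).
  apply ex_zseries_gauss with (PI * x) (1 / 2); [nra|intros k].
  unfold theta1p_term. rewrite !Rabs_mult, Rabs_powerRZ_m1.
  replace (2 * IZR k + 1) with (2 * (IZR k + 1 / 2)) by field.
  rewrite Rabs_mult, (Rabs_pos_eq 2), (Rabs_pos_eq (exp _))
    by (lra || apply Rlt_le, exp_pos).
  replace (- (PI * x) * (IZR k + 1 / 2) ^ 2)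
    with (- PI * (IZR k + 1 / 2) ^ 2 * x) by ring.
  apply Rmult_le_compat_r; [apply Rlt_le, exp_pos|lra].
Qed.

Lemma theta2_cv (x : R) (hx : 0 < x) :
  ex_zseries (fun k => Rabs (theta2_term x k)).
Proof.
  assert (Hp := PI_RGT_0).
  apply ex_zseries_gauss with (PI * x) (- (1 / 2)); [nra|intros k].
  unfold theta2_term. rewrite (Rabs_pos_eq (exp _)) by apply Rlt_le, exp_pos.
  replace (- (PI * x) * (IZR k + - (1 / 2)) ^ 2)
    with (- PI * (IZR k - 1 / 2) ^ 2 * x) by ring.
  assert (H := Rabs_pos (IZR k + - (1 / 2))).
  assert (H' := exp_pos (- PI * (IZR k - 1 / 2) ^ 2 * x)). nra.
Qed.

Lemma theta3_cv (x : R) (hx : 0 < x) :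
  ex_zseries (fun k => Rabs (theta3_term x k)).
Proof.
  assert (Hp := PI_RGT_0).
  apply ex_zseries_gauss with (PI * x) 0; [nra|intros k].
  unfold theta3_term. rewrite (Rabs_pos_eq (exp _)) by apply Rlt_le, exp_pos.
  replace (- (PI * x) * (IZR k + 0) ^ 2) with (- PI * IZR k ^ 2 * x) by ring.
  assert (H := Rabs_pos (IZR k + 0)).
  assert (H' := exp_pos (- PI * IZR k ^ 2 * x)). nra.
Qed.

Lemma theta4_cv (x : R) (hx : 0 < x) :
  ex_zseries (fun k => Rabs (theta4_term x k)).
Proof.
  assert (H := theta3_cv x hx).
  unfold ex_zseries, theta3_term in H; unfold ex_zseries, theta4_term.
  split; [destruct H as [H _]|destruct H as [_ H]]; revert H;
    apply ex_series_ext; intros n;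
    rewrite Rabs_mult, Rabs_powerRZ_m1; symmetry; apply Rmult_1_l.
Qed.

Lemma eta_prod_cv (x : R) (hx : 0 < x) :
  ex_finite_lim_seq
    (partial_prod (fun k : nat => (1 - exp (- 2 * INR k * PI * x)) ^ 3)).
Proof.
  set (f := fun k : nat => _).
  assert (Hf : forall k, 0 <= f k <= 1).
  { intros k. unfold f.
    assert (Hp := PI_RGT_0). assert (Hk := pos_INR k).
    set (e := exp _). assert (0 < e) by apply exp_pos.
    assert (e <= 1).
    { unfold e. rewrite <- exp_0. apply exp_incr_le.
      assert (0 <= INR k * PI) by nra. nra. }
    split; [apply pow_le; lra|].
    rewrite <- (pow1 3). apply pow_incr. lra. }
  assert (H0 : forall N, 0 <= partial_prod f N).
  { intros N. unfold partial_prod.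
    induction N as [|N IH]; simpl; [apply Hf|].
    apply Rmult_le_pos; [exact IH|apply Hf]. }
  apply ex_finite_lim_seq_decr with 0; [|exact H0].
  intros N. specialize (H0 N). unfold partial_prod in *. simpl.
  specialize (Hf (S (S N))). nra.
Qed.

(* Main.v *)
Require Import Defs.
From Stdlib Require Import Reals ZArith Lia Lra.
From Coquelicot Require Import Coquelicot.
Open Scope R_scope.

(** With [q = exp (- pi x)], Jacobi's triple product turns [theta2], [theta3],
    [theta4] into infinite products, and its derivative at the zero [z = -1]
    does the same for [theta1p]; both are limits of finite identities, proved by
    induction from a Pascal-type rule for the central [q]-binomials.

    The symmetry [x -> 1/x] reduces to [theta3 (1/x) = sqrt x * theta3 x], which
    is obtained as in Polya's proof: summing [cos^(2m)] over [n] equidistant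
    points gives [n] times the sum of every [n]-th coefficient of the expansion
    of [cos^(2m)], and with [m ~ s n^2] both sides tend to Gaussian sums.

    In the product every factor has [1 - exp (- k e^t)] log-concave in [t], and
    [exp (- pi e^t / 4)] is strictly so; hence the logarithmic derivative
    decreases strictly, and by symmetry it vanishes at [x = 1]. *)

(** * Two-sided series *)

(** Neither infinite products nor two-variable series are ever differentiated. For the cube identity
    the derivative in z is replaced by the weight k in the sum, and the recurrence for weighted sums
    couples the weight k only to the weight 1. For log-concavity, increments under x -> lam x are
    compared: this passes through finite products and their limits as a weak inequality, while exp
    (- (PI / 4) x) contributes a gap of first order in lam - 1, so strictness survives one
    differentiation at lam = 1.

    The equation for [theta3] is obtained in squared form, because monotonicity gives easy
    convergence for the square of the central binomial coefficient (Wallis). The value of that limit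
    is not computed beforehand.

    Every passage to the limit is dominated convergence, so each finite identity is accompanied by a
    bound uniform in its parameter. *)

Lemma ex_series_dominated (a b : nat -> R) :
  (forall n, Rabs (a n) <= b n) -> ex_series b -> ex_series a.
Proof.
  intros H. exact (@ex_series_le R_AbsRing R_CompleteNormedModule a b H).
Qed.

Lemma series_dominated (a b : nat -> R) :
  (forall n, Rabs (a n) <= b n) -> ex_series b -> Rabs (Series a) <= Series b.
Proof.
  intros H Hb. eapply Rle_trans.
  - apply Series_Rabs. apply ex_series_dominated with b; [|exact Hb].
    intros n. rewrite Rabs_Rabsolu. apply H.
  - apply Series_le; [|exact Hb]. intros n. split; [apply Rabs_pos|apply H].
Qed.

Lemma lim_sum_n (f : nat -> nat -> R) (l : nat -> R) (m : nat) :
  (forall n, is_lim_seq (fun p => f p n) (l n)) ->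
  is_lim_seq (fun p => sum_n (f p) m) (sum_n l m).
Proof.
  intros H. induction m as [|m IH].
  - apply is_lim_seq_ext with (fun p => f p O); [|rewrite sum_O; apply H].
    intros p. now rewrite sum_O.
  - apply is_lim_seq_ext with (fun p => sum_n (f p) m + f p (S m)).
    + intros p. now rewrite sum_Sn.
    + rewrite sum_Sn. apply is_lim_seq_plus'; auto.
Qed.

Lemma series_tail_small (g : nat -> R) (eps : posreal) :
  ex_series g ->
  exists m, Rabs (Series (fun n => g (S m + n)%nat)) < eps.
Proof.
  intros Hg. assert (Hs : is_lim_seq (sum_n g) (Series g)) by exact (Series_correct _ Hg).
  apply is_lim_seq_spec in Hs. destruct (Hs eps) as [m Hm].
  exists m. specialize (Hm m (Nat.le_refl m)).
  rewrite (Series_incr_n g (S m)) in Hm; [|lia|exact Hg].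
  simpl Init.Nat.pred in Hm. rewrite <- sum_n_Reals in Hm.
  replace (sum_n g m - _) with (- Series (fun n => g (S m + n)%nat)) in Hm by ring.
  now rewrite Rabs_Ropp in Hm.
Qed.

(** Dominated convergence: beyond a suitable m both tails are at most the tail of [g], which is
    below eps / 3, and the finite heads converge termwise. *)
Lemma series_tannery (f : nat -> nat -> R) (l g : nat -> R) :
  (forall p n, Rabs (f p n) <= g n) -> ex_series g ->
  (forall n, is_lim_seq (fun p => f p n) (l n)) ->
  is_lim_seq (fun p => Series (f p)) (Series l).
Proof.
  intros Hb Hg Hl.
  assert (Hlb : forall n, Rabs (l n) <= g n).
  { intros n. apply (is_lim_seq_le (fun p => Rabs (f p n)) (fun _ => g n)
      (Rabs (l n)) (g n)); [auto| |apply is_lim_seq_const].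
    apply (is_lim_seq_abs _ (l n)), Hl. }
  apply is_lim_seq_spec. intros eps.
  destruct (series_tail_small g (mkposreal (eps / 3) ltac:(destruct eps; simpl; lra)) Hg)
    as [m Hm]. simpl in Hm.
  assert (Hs := lim_sum_n f l m Hl). apply is_lim_seq_spec in Hs.
  destruct (Hs (mkposreal (eps / 3) ltac:(destruct eps; simpl; lra))) as [N HN].
  exists N. intros p Hp. specialize (HN p Hp). simpl in HN.
  assert (Hgt : ex_series (fun n => g (S m + n)%nat)) by now apply ex_series_incr_n.
  rewrite (Series_incr_n (f p) (S m)), (Series_incr_n l (S m));
    try lia; try (now apply ex_series_dominated with g).
  simpl Init.Nat.pred. rewrite <- !sum_n_Reals.
  set (u := Series _). set (v := Series _).
  assert (Hu : Rabs u <= Series (fun n => g (S m + n)%nat))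
    by (apply series_dominated; auto).
  assert (Hv : Rabs v <= Series (fun n => g (S m + n)%nat))
    by (apply series_dominated; auto).
  simpl in *.
  destruct eps as [eps He]; simpl in *.
  revert HN Hm Hu Hv. unfold Rabs. repeat destruct Rcase_abs; lra.
Qed.

Definition zsummable (a : Z -> R) : Prop := ex_zseries (fun k => Rabs (a k)).

Lemma zsummable_le (a b : Z -> R) :
  (forall k, Rabs (a k) <= Rabs (b k)) -> zsummable b -> zsummable a.
Proof.
  intros H [H1 H2]. split; [revert H1|revert H2]; apply ex_series_dominated;
    intros n; rewrite Rabs_Rabsolu; apply H.
Qed.

Lemma zsummable_ex (a : Z -> R) : zsummable a -> ex_zseries a.
Proof.
  intros [H1 H2]. split; now apply ex_series_Rabs.
Qed.

Lemma zsummable_scal (c : R) (a : Z -> R) :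
  zsummable a -> zsummable (fun k => c * a k).
Proof.
  intros [H1 H2]. split; [apply (ex_series_scal (Rabs c)) in H1; revert H1
                         |apply (ex_series_scal (Rabs c)) in H2; revert H2];
    apply ex_series_ext; intros n; symmetry; apply Rabs_mult.
Qed.

Lemma zsummable_plus (a b : Z -> R) :
  zsummable a -> zsummable b -> zsummable (fun k => a k + b k).
Proof.
  intros [H1 H2] [H3 H4].
  split; [apply (ex_series_plus _ _ H1) in H3; revert H3
         |apply (ex_series_plus _ _ H2) in H4; revert H4];
    apply ex_series_dominated; intros n; rewrite Rabs_Rabsolu;
    apply Rabs_triang.
Qed.

Lemma zsummable_ext (a b : Z -> R) :
  (forall k, a k = b k) -> zsummable a -> zsummable b.
Proof.
  intros H. apply zsummable_le. intros k. rewrite H. apply Rle_refl.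
Qed.

Lemma zsummable_succ (a : Z -> R) :
  zsummable a -> zsummable (fun k => a (k + 1)%Z).
Proof.
  intros [H1 H2]. split.
  - apply (ex_series_incr_1 (fun n => Rabs (a (Z.of_nat n)))) in H1.
    revert H1. apply ex_series_ext. intros n. do 2 f_equal. lia.
  - apply ex_series_incr_1. revert H2. apply ex_series_ext.
    intros n. do 2 f_equal. lia.
Qed.

Lemma zsummable_pred (a : Z -> R) :
  zsummable a -> zsummable (fun k => a (k - 1)%Z).
Proof.
  intros [H1 H2]. split.
  - apply ex_series_incr_1. revert H1. apply ex_series_ext.
    intros n. do 2 f_equal. lia.
  - apply (ex_series_incr_1 (fun n => Rabs (a (- Z.of_nat (S n))%Z))) in H2.
    revert H2. apply ex_series_ext. intros n. do 2 f_equal. lia.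
Qed.

Lemma zsummable_gauss (a : Z -> R) (K c s : R) :
  0 < c -> 0 < K ->
  (forall k, Rabs (a k)
     <= K * ((1 + 2 * Rabs (IZR k + s)) * exp (- c * (IZR k + s) ^ 2))) ->
  zsummable a.
Proof.
  intros Hc HK Ha.
  assert (H : zsummable (fun k => / K * a k)).
  { apply (ex_zseries_gauss _ c s Hc). intros k.
    rewrite Rabs_mult, (Rabs_pos_eq (/ K)) by (apply Rlt_le, Rinv_0_lt_compat, HK).
    apply Rmult_le_reg_l with K; [exact HK|].
    rewrite <- Rmult_assoc, Rinv_r, Rmult_1_l by lra. apply Ha. }
  apply (zsummable_scal K) in H. revert H. apply zsummable_ext.
  intros k. field. lra.
Qed.

Lemma zseries_ext (a b : Z -> R) :
  (forall k, a k = b k) -> zseries a = zseries b.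
Proof.
  intros H. unfold zseries. f_equal; apply Series_ext; intros; apply H.
Qed.

Lemma zseries_scal (c : R) (a : Z -> R) :
  zseries (fun k => c * a k) = c * zseries a.
Proof.
  unfold zseries. rewrite !Series_scal_l. ring.
Qed.

Lemma zseries_plus (a b : Z -> R) :
  zsummable a -> zsummable b ->
  zseries (fun k => a k + b k) = zseries a + zseries b.
Proof.
  intros Ha Hb. apply zsummable_ex in Ha, Hb.
  destruct Ha, Hb. unfold zseries. rewrite !Series_plus by assumption. ring.
Qed.

Lemma zseries_minus (a b : Z -> R) :
  zsummable a -> zsummable b ->
  zseries (fun k => a k - b k) = zseries a - zseries b.
Proof.
  intros Ha Hb.
  rewrite (zseries_ext _ (fun k => a k + (- 1) * b k)) by (intros; ring).
  rewrite zseries_plus, zseries_scal; [ring|exact Ha|now apply zsummable_scal].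
Qed.

(** The shift only moves the term [a 0] from the nonnegative half to the negative one. *)
Lemma zseries_succ (a : Z -> R) :
  zsummable a -> zseries (fun k => a (k + 1)%Z) = zseries a.
Proof.
  intros Ha.
  destruct (zsummable_ex _ (zsummable_succ _ Ha)) as [_ H2].
  apply zsummable_ex in Ha. destruct Ha as [H1 _].
  unfold zseries. rewrite (Series_incr_1 _ H1), (Series_incr_1 _ H2).
  rewrite (Series_ext (fun n => a (Z.of_nat n + 1)%Z) (fun k => a (Z.of_nat (S k))))
    by (intros n; f_equal; lia).
  rewrite (Series_ext (fun k => a (- Z.of_nat (S (S k)) + 1)%Z)
             (fun n => a (- Z.of_nat (S n))%Z))
    by (intros n; f_equal; lia).
  simpl. ring.
Qed.

Lemma zseries_pred (a : Z -> R) :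
  zsummable a -> zseries (fun k => a (k - 1)%Z) = zseries a.
Proof.
  intros Ha. rewrite <- (zseries_succ (fun k => a (k - 1)%Z)).
  - apply zseries_ext. intros k. f_equal. ring.
  - now apply zsummable_pred.
Qed.

Lemma zseries_tannery (f : nat -> Z -> R) (l g : Z -> R) :
  (forall p k, Rabs (f p k) <= Rabs (g k)) -> zsummable g ->
  (forall k, is_lim_seq (fun p => f p k) (l k)) ->
  is_lim_seq (fun p => zseries (f p)) (zseries l).
Proof.
  intros Hb [H1 H2] Hl. apply is_lim_seq_plus'.
  - apply (series_tannery (fun p n => f p (Z.of_nat n)) _
             (fun n => Rabs (g (Z.of_nat n)))); auto.
  - apply (series_tannery (fun p n => f p (- Z.of_nat (S n))%Z) _
             (fun n => Rabs (g (- Z.of_nat (S n))%Z))); auto.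
Qed.

Lemma zseries_dirac (c : R) :
  zseries (fun k => if (k =? 0)%Z then c else 0) = c.
Proof.
  unfold zseries.
  (* Zero is written as [0 * 0] so that [Series_scal_l] evaluates the series without a convergence
     proof. *)
  rewrite (Series_ext (fun n => if (- Z.of_nat (S n) =? 0)%Z then c else 0)
             (fun _ => 0 * 0)) by (intros n; simpl; ring).
  rewrite Series_scal_l.
  rewrite (Series_incr_1 (fun n => if (Z.of_nat n =? 0)%Z then c else 0)).
  - rewrite (Series_ext (fun k => if (Z.of_nat (S k) =? 0)%Z then c else 0)
               (fun _ => 0 * 0)) by (intros n; simpl; ring).
    rewrite Series_scal_l. simpl. ring.
  - apply ex_series_incr_1. apply ex_series_ext with (fun _ => 0 ^ S 0 * 0 ^ 0).
    + intros n. simpl. ring.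
    + apply ex_series_dominated with (fun n => (1 / 2) ^ n).
      * intros n. replace (0 ^ 1 * 0 ^ 0) with 0 by ring. rewrite Rabs_R0.
        apply pow_le. lra.
      * apply ex_series_geom. rewrite Rabs_pos_eq; lra.
Qed.

(* [n] terms, whereas [sum_n b n] has [n + 1]. *)
Definition psum (b : nat -> R) (n : nat) : R :=
  match n with O => 0 | S m => sum_n b m end.

Lemma psum_S (b : nat -> R) (n : nat) : psum b (S n) = psum b n + b n.
Proof.
  destruct n; simpl; [rewrite sum_O; ring|now rewrite sum_Sn].
Qed.

(** The first n * k terms form k complete blocks, and in each block only the position r can be
    nonzero. *)
Lemma psum_stride (b : nat -> R) (n r : nat) :
  (r < n)%nat -> (forall i, (i mod n <> r)%nat -> b i = 0) ->
  forall k, psum b (n * k) = psum (fun j => b (n * j + r)%nat) k.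
Proof.
  intros Hr Hb.
  assert (H : forall k m, (m <= n)%nat ->
    psum b (n * k + m) = psum b (n * k) + if (r <? m)%nat then b (n * k + r)%nat else 0).
  { intros k m. induction m as [|m IH]; intros Hm.
    - rewrite Nat.add_0_r. simpl. ring.
    - rewrite Nat.add_succ_r, psum_S, IH by lia.
      destruct (Nat.ltb_spec r m) as [H1|H1], (Nat.ltb_spec r (S m)) as [H2|H2];
        try lia.
      + rewrite (Hb (n * k + m)%nat); [ring|].
        rewrite Nat.add_comm, Nat.mul_comm, Nat.Div0.mod_add, Nat.mod_small; lia.
      + replace m with r by lia. ring.
      + rewrite (Hb (n * k + m)%nat); [ring|].
        rewrite Nat.add_comm, Nat.mul_comm, Nat.Div0.mod_add, Nat.mod_small; lia. }
  induction k as [|k IH].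
  - rewrite Nat.mul_0_r. reflexivity.
  - rewrite psum_S, <- IH, Nat.mul_succ_r, H by lia.
    destruct (Nat.ltb_spec r n); [reflexivity|lia].
Qed.

Lemma psum_lim (b : nat -> R) : ex_series b -> is_lim_seq (psum b) (Series b).
Proof.
  intros Hb. apply is_lim_seq_incr_1. exact (Series_correct _ Hb).
Qed.

Lemma series_stride (b : nat -> R) (n r : nat) :
  (r < n)%nat -> (forall i, (i mod n <> r)%nat -> b i = 0) -> ex_series b ->
  Series (fun k => b (n * k + r)%nat) = Series b.
Proof.
  intros Hr Hb Hs. apply is_series_unique.
  assert (H : is_lim_seq (psum (fun k => b (n * k + r)%nat)) (Series b)).
  { apply is_lim_seq_ext with (fun k => psum b (n * k)).
    - now apply psum_stride.
    - apply (is_lim_seq_subseq (psum b) (Series b) (fun k => n * k)%nat).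
      + apply eventually_subseq. intros k. lia.
      + now apply psum_lim. }
  apply is_lim_seq_incr_1 in H. exact H.
Qed.

Definition on_multiples (n : Z) (a : Z -> R) (j : Z) : R :=
  if (j mod n =? 0)%Z then a j else 0.

Lemma zsummable_on_multiples (n : Z) (a : Z -> R) :
  zsummable a -> zsummable (on_multiples n a).
Proof.
  apply zsummable_le. intros k. unfold on_multiples.
  destruct (_ =? _)%Z; [lra|rewrite Rabs_R0; apply Rabs_pos].
Qed.

Lemma zseries_on_multiples (n : Z) (a : Z -> R) :
  (0 < n)%Z -> zsummable a ->
  zseries (on_multiples n a) = zseries (fun k => a (n * k)%Z).
Proof.
  intros Hn Ha.
  destruct (zsummable_ex _ (zsummable_on_multiples n a Ha)) as [H1 H2].
  destruct (Z_of_nat_complete n ltac:(lia)) as [m ->].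
  unfold zseries. f_equal.
  - rewrite <- (series_stride _ m 0); [|lia| |exact H1].
    + apply Series_ext. intros k. unfold on_multiples.
      replace (Z.of_nat (m * k + 0)) with (Z.of_nat m * Z.of_nat k)%Z by lia.
      rewrite Z.mul_comm, Z_mod_mult. reflexivity.
    + intros i Hi. unfold on_multiples.
      rewrite <- Nat2Z.inj_mod. destruct (Z.eqb_spec (Z.of_nat (i mod m)) 0); [lia|easy].
  (* The negative half has index -(i + 1) at position i, so multiples of m sit at the positions i
     congruent to m - 1. *)
  - rewrite <- (series_stride _ m (m - 1)); [|lia| |exact H2].
    + apply Series_ext. intros k. unfold on_multiples.
      replace (- Z.of_nat (S (m * k + (m - 1))))%Z
        with (Z.of_nat m * (- Z.of_nat (S k)))%Z by nia.
      rewrite Z.mul_comm, Z_mod_mult. reflexivity.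
    + intros i Hi. unfold on_multiples.
      destruct (Z.eqb_spec (- Z.of_nat (S i) mod Z.of_nat m) 0) as [E|]; [exfalso|easy].
      apply Hi. apply Z_mod_zero_opp_full in E. rewrite Z.opp_involutive in E.
      rewrite <- Nat2Z.inj_mod in E.
      assert (Hm := Nat.div_mod_eq (S i) m).
      replace (S i mod m)%nat with O in Hm by lia.
      destruct (S i / m)%nat as [|k]; [lia|].
      replace i with (m - 1 + k * m)%nat by nia.
      rewrite Nat.Div0.mod_add. apply Nat.mod_small. lia.
Qed.

(** * The triple product *)

(** This is p^k for the base p = exp (-2c), and [qpoch c n] is (p; p)_n. The theta functions use c =
    PI * x, so p is the square of the nome exp (- PI x). *)
Definition qexp (c : R) (k : Z) : R := exp (- 2 * c * IZR k).

Fixpoint qpoch (c : R) (n : nat) : R :=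
  match n with
  | O => 1
  | S m => qpoch c m * (1 - qexp c (Z.of_nat n))
  end.

Definition qpoch_inv (c : R) (m : Z) : R :=
  if (m <? 0)%Z then 0 else / qpoch c (Z.to_nat m).

(** The Gaussian binomial coefficient (2N choose N + k) in base p, centred so that it has a limit
    for fixed k. *)
Definition qbinom (c : R) (N : nat) (k : Z) : R :=
  qpoch c (2 * N) * qpoch_inv c (Z.of_nat N + k) * qpoch_inv c (Z.of_nat N - k).

Lemma qexp_plus (c : R) (j k : Z) : qexp c (j + k) = qexp c j * qexp c k.
Proof.
  unfold qexp. rewrite <- exp_plus, plus_IZR. f_equal. ring.
Qed.

Lemma qexp_lt1 (c : R) (k : Z) : 0 < c -> (0 < k)%Z -> qexp c k < 1.
Proof.
  intros Hc Hk. apply IZR_lt in Hk. unfold qexp. rewrite <- exp_0.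
  apply exp_increasing. nra.
Qed.

Lemma qpoch_pos (c : R) (n : nat) : 0 < c -> 0 < qpoch c n.
Proof.
  intros Hc. induction n as [|n IH]; [simpl; lra|].
  change (0 < qpoch c n * (1 - qexp c (Z.of_nat (S n)))).
  apply Rmult_lt_0_compat; [exact IH|].
  assert (H := qexp_lt1 c (Z.of_nat (S n)) Hc ltac:(lia)). lra.
Qed.

Lemma qpoch_decr (c : R) (n : nat) : 0 < c -> qpoch c (S n) <= qpoch c n.
Proof.
  intros Hc. change (qpoch c n * (1 - qexp c (Z.of_nat (S n))) <= qpoch c n).
  assert (H := qpoch_pos c n Hc).
  assert (H' : 0 < qexp c (Z.of_nat (S n))) by apply exp_pos. nra.
Qed.

Lemma qpoch_le1 (c : R) (n : nat) : 0 < c -> qpoch c n <= 1.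
Proof.
  intros Hc. induction n as [|n IH]; [simpl; lra|].
  eapply Rle_trans; [now apply qpoch_decr|exact IH].
Qed.

(** Apply 1 + t <= exp t at t = u / (1 - v) and use (1 - u)(1 + t) = 1 + u (v - u) / (1 - v) >=
    1. *)
Lemma one_minus_ge_exp (u v : R) : 0 <= u -> u <= v -> v < 1 -> exp (- (u / (1 - v))) <= 1 - u.
Proof.
  intros H0 H1 H2.
  assert (H := exp_ineq1_le (u / (1 - v))).
  assert (Hi : 0 < / (1 - v)) by (apply Rinv_0_lt_compat; lra).
  assert (He : exp (- (u / (1 - v))) * exp (u / (1 - v)) = 1)
    by (rewrite <- exp_plus, Rplus_opp_l; apply exp_0).
  assert (Hp := exp_pos (- (u / (1 - v)))).
  assert (Hq : 1 <= (1 - u) * (1 + u / (1 - v))).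
  { replace ((1 - u) * (1 + u / (1 - v)))
      with (1 + u * (v - u) * / (1 - v)) by (field; lra).
    assert (0 <= u * (v - u) * / (1 - v)) by (apply Rmult_le_pos; nra). lra. }
  apply Rle_trans with (exp (- (u / (1 - v))) * ((1 - u) * exp (u / (1 - v)))); [|nra].
  rewrite <- (Rmult_1_r (exp _)) at 1. apply Rmult_le_compat_l; [lra|].
  eapply Rle_trans; [exact Hq|]. apply Rmult_le_compat_l; lra.
Qed.

Lemma qpoch_lower (c : R) : 0 < c -> exists L, 0 < L /\ forall n, L <= qpoch c n.
Proof.
  intros Hc. set (q := qexp c 1).
  assert (Hq0 : 0 < q) by apply exp_pos.
  assert (Hq1 : q < 1) by (apply qexp_lt1; [exact Hc|lia]).
  (* Each factor 1 - q^j is at least exp (- q^j / (1 - q)), and the exponents q^j sum to q / (1 -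
     q). The induction below carries the partial geometric sum. *)
  exists (exp (- (q / (1 - q) ^ 2))). split; [apply exp_pos|].
  assert (Hpow : forall n, qexp c (Z.of_nat n) = q ^ n).
  { induction n as [|n IH].
    - unfold qexp. simpl. rewrite Rmult_0_r. apply exp_0.
    - replace (Z.of_nat (S n)) with (1 + Z.of_nat n)%Z by lia.
      rewrite qexp_plus, IH. reflexivity. }
  assert (H : forall n, exp (- ((q - q ^ S n) / (1 - q) ^ 2)) <= qpoch c n).
  { induction n as [|n IH].
    - simpl. rewrite Rmult_1_r. unfold Rdiv. rewrite Rminus_diag, Rmult_0_l, Ropp_0, exp_0. lra.
    - change (qpoch c (S n)) with (qpoch c n * (1 - qexp c (Z.of_nat (S n)))).
      rewrite Hpow.
      replace (- ((q - q ^ S (S n)) / (1 - q) ^ 2))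
        with (- ((q - q ^ S n) / (1 - q) ^ 2) + - (q ^ S n / (1 - q)))
        by (simpl; field; lra).
      rewrite exp_plus.
      assert (Hn : 0 < q ^ n) by now apply pow_lt.
      assert (Hn' : q ^ n <= 1) by (rewrite <- (pow1 n); apply pow_incr; lra).
      apply Rmult_le_compat; try (apply Rlt_le, exp_pos); [exact IH|].
      apply one_minus_ge_exp; simpl; nra. }
  intros n. eapply Rle_trans; [|apply H]. apply exp_incr_le.
  assert (Hn : 0 < q ^ S n) by now apply pow_lt.
  apply Ropp_le_contravar. unfold Rdiv. apply Rmult_le_compat_r; [|lra].
  apply Rlt_le, Rinv_0_lt_compat, pow_lt. lra.
Qed.

Definition qpoch_inf (c : R) : R := real (Lim_seq (qpoch c)).

Lemma qpoch_lim (c : R) : 0 < c -> is_lim_seq (qpoch c) (qpoch_inf c).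
Proof.
  intros Hc. apply Lim_seq_correct', ex_finite_lim_seq_decr with 0; intros n.
  - now apply qpoch_decr.
  - now apply Rlt_le, qpoch_pos.
Qed.

Lemma qpoch_inf_pos (c : R) : 0 < c -> 0 < qpoch_inf c.
Proof.
  intros Hc. destruct (qpoch_lower c Hc) as [L [HL H]].
  apply Rlt_le_trans with L; [exact HL|].
  exact (is_lim_seq_le (fun _ => L) (qpoch c) L (qpoch_inf c) H
           (is_lim_seq_const L) (qpoch_lim c Hc)).
Qed.

(* With 1/(q;q)_m = 0 for m < 0 this holds for every integer m, so that the
   Pascal-type recurrence below needs no boundary cases. *)
Lemma qpoch_inv_pred (c : R) (m : Z) :
  0 < c -> qpoch_inv c (m - 1) = (1 - qexp c m) * qpoch_inv c m.
Proof.
  intros Hc. unfold qpoch_inv.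
  destruct (Z.ltb_spec (m - 1) 0), (Z.ltb_spec m 0); try lia; [ring| |].
  - replace m with 0%Z by lia. unfold qexp. rewrite Rmult_0_r, exp_0. ring.
  - destruct (Z_of_nat_complete m ltac:(lia)) as [[|n] ->]; [lia|].
    replace (Z.of_nat (S n) - 1)%Z with (Z.of_nat n) by lia. rewrite !Nat2Z.id.
    change (qpoch c (S n)) with (qpoch c n * (1 - qexp c (Z.of_nat (S n)))).
    assert (Hp := qpoch_pos c n Hc).
    assert (Hq := qexp_lt1 c (Z.of_nat (S n)) Hc ltac:(lia)).
    field. lra.
Qed.

(** The rule mirrors multiplication by (1 + z p^(n+1)) (1 + p^n / z), whose expansion has the terms
    1 + p^(2n+1), z p^(n+1) and p^n / z. Once all values of [qpoch_inv] are reduced to the arguments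
    n + 1 + k and n + 1 - k, only a polynomial identity remains. *)
Lemma qbinom_rec (c : R) (N : nat) (k : Z) :
  0 < c ->
  let n := Z.of_nat N in
  qbinom c (S N) k =
    (1 + qexp c (2 * n + 1)) * qbinom c N k
    + qexp c (n + 1 - k) * qbinom c N (k - 1)
    + qexp c (n + 1 + k) * qbinom c N (k + 1).
Proof.
  intros Hc n. unfold qbinom.
  replace (2 * S N)%nat with (S (S (2 * N))) by lia.
  change (qpoch c (S (S (2 * N))))
    with (qpoch c (2 * N) * (1 - qexp c (Z.of_nat (S (2 * N))))
          * (1 - qexp c (Z.of_nat (S (S (2 * N)))))).
  replace (Z.of_nat (S (S (2 * N)))) with ((n + 1 + k) + (n + 1 - k))%Z by lia.
  replace (Z.of_nat (S (2 * N))) with (2 * n + 1)%Z by lia.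
  replace (Z.of_nat (S N) + k)%Z with (n + 1 + k)%Z by lia.
  replace (Z.of_nat (S N) - k)%Z with (n + 1 - k)%Z by lia.
  replace (Z.of_nat N + k)%Z with (n + 1 + k - 1)%Z by lia.
  replace (Z.of_nat N - k)%Z with (n + 1 - k - 1)%Z by lia.
  replace (Z.of_nat N + (k - 1))%Z with (n + 1 + k - 1 - 1)%Z by lia.
  replace (Z.of_nat N + (k + 1))%Z with (n + 1 + k)%Z by lia.
  replace (Z.of_nat N - (k - 1))%Z with (n + 1 - k)%Z by lia.
  replace (Z.of_nat N - (k + 1))%Z with (n + 1 - k - 1 - 1)%Z by lia.
  rewrite !qpoch_inv_pred by exact Hc.
  assert (HQ : forall m, qexp c (m - 1) = qexp c m * qexp c (- 1))
    by (intros m; rewrite <- qexp_plus; f_equal; ring).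
  replace (qexp c (2 * n + 1))
    with (qexp c (n + 1 + k) * qexp c (n + 1 - k) * qexp c (- 1))
    by (rewrite <- !qexp_plus; f_equal; ring).
  rewrite !HQ, !qexp_plus. ring.
Qed.

Lemma qpoch_inv_bound (c : R) :
  0 < c -> exists M, 0 < M /\ forall m, 0 <= qpoch_inv c m <= M.
Proof.
  intros Hc. destruct (qpoch_lower c Hc) as [L [HL H]].
  assert (HM := Rinv_0_lt_compat _ HL).
  exists (/ L). split; [exact HM|]. intros m. unfold qpoch_inv.
  destruct (_ <? _)%Z; [lra|]. split.
  - now apply Rlt_le, Rinv_0_lt_compat, qpoch_pos.
  - now apply Rinv_le_contravar.
Qed.

(** Uniformity in both N and k is what allows N to tend to infinity inside the two-sided series. *)
Lemma qbinom_bound (c : R) :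
  0 < c -> exists M, 0 < M /\ forall N k, Rabs (qbinom c N k) <= M.
Proof.
  intros Hc. destruct (qpoch_inv_bound c Hc) as [M [HM H]].
  exists (M * M). split; [nra|]. intros N k. unfold qbinom.
  assert (H1 := H (Z.of_nat N + k)%Z). assert (H2 := H (Z.of_nat N - k)%Z).
  assert (H3 := qpoch_pos c (2 * N) Hc). assert (H4 := qpoch_le1 c (2 * N) Hc).
  set (u := qpoch_inv c _) in *. set (v := qpoch_inv c (_ - _)) in *.
  set (p := qpoch c _) in *.
  assert (H5 : 0 <= u * v <= M * M) by (split; nra).
  rewrite Rmult_assoc, Rabs_pos_eq; nra.
Qed.

Lemma qpoch_inv_lim (c : R) (k : Z) :
  0 < c -> is_lim_seq (fun N => qpoch_inv c (Z.of_nat N + k)) (/ qpoch_inf c).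
Proof.
  (* Starting at N = |k| keeps N + k nonnegative, so the default value 0 of [qpoch_inv] does not
     occur. *)
  intros Hc. apply (is_lim_seq_incr_n _ (Z.to_nat (Z.abs k))).
  apply is_lim_seq_ext with
    (fun N => / qpoch c (N + Z.to_nat (Z.abs k + k))).
  - intros N. unfold qpoch_inv.
    destruct (Z.ltb_spec (Z.of_nat (N + Z.to_nat (Z.abs k)) + k) 0); [lia|].
    do 2 f_equal. lia.
  - apply (is_lim_seq_incr_n (fun N => / qpoch c N)).
    apply (is_lim_seq_inv (qpoch c) (qpoch_inf c)); [now apply qpoch_lim|].
    assert (H := qpoch_inf_pos c Hc). intros E. injection E. lra.
Qed.

Lemma qbinom_lim (c : R) (k : Z) :
  0 < c -> is_lim_seq (fun N => qbinom c N k) (/ qpoch_inf c).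
Proof.
  intros Hc. assert (Hp := qpoch_inf_pos c Hc).
  replace (/ qpoch_inf c) with (qpoch_inf c * / qpoch_inf c * / qpoch_inf c)
    by (field; lra).
  apply is_lim_seq_mult'; [apply is_lim_seq_mult'|].
  - apply (is_lim_seq_subseq (qpoch c) (qpoch_inf c) (fun N => 2 * N)%nat).
    + apply eventually_subseq. intros n. lia.
    + now apply qpoch_lim.
  - now apply qpoch_inv_lim.
  - now apply (qpoch_inv_lim c (- k)).
Qed.

(** This is z^k p^(k(k+1)/2) with z = s exp w: the sign s and the logarithm w of the modulus are
    kept apart, so that z may be negative. *)
Definition jterm (c s w : R) (k : Z) : R :=
  powerRZ s k * exp (IZR k * w - c * (IZR k * (IZR k + 1))).

Lemma sign_sqr (s : R) : Rabs s = 1 -> s * s = 1.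
Proof.
  unfold Rabs. destruct Rcase_abs; nra.
Qed.

Lemma sign_neq0 (s : R) : Rabs s = 1 -> s <> 0.
Proof.
  intros H E. rewrite E, Rabs_R0 in H. lra.
Qed.

Lemma jterm_succ (c s w : R) (k : Z) :
  Rabs s = 1 -> jterm c s w (k + 1) = s * exp w * qexp c (k + 1) * jterm c s w k.
Proof.
  intros Hs. unfold jterm, qexp.
  rewrite powerRZ_add, powerRZ_1 by now apply sign_neq0.
  replace (s * exp w * exp (- 2 * c * IZR (k + 1))
           * (powerRZ s k * exp (IZR k * w - c * (IZR k * (IZR k + 1)))))
    with (powerRZ s k * s * (exp w * exp (- 2 * c * IZR (k + 1))
           * exp (IZR k * w - c * (IZR k * (IZR k + 1))))) by ring.
  rewrite <- !exp_plus. f_equal. f_equal. rewrite !plus_IZR. ring.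
Qed.

Lemma jterm_pred (c s w : R) (k : Z) :
  Rabs s = 1 -> jterm c s w (k - 1) = s * exp (- w) * qexp c (- k) * jterm c s w k.
Proof.
  intros Hs. assert (H := jterm_succ c s w (k - 1) Hs).
  replace (k - 1 + 1)%Z with k in H by ring. rewrite H.
  assert (H1 := sign_sqr s Hs).
  assert (H2 : exp (- w) * exp w = 1) by (rewrite <- exp_plus, Rplus_opp_l; apply exp_0).
  assert (H3 : qexp c (- k) * qexp c k = 1).
  { rewrite <- qexp_plus, Z.add_opp_diag_l. unfold qexp.
    rewrite Rmult_0_r. apply exp_0. }
  replace (s * exp (- w) * qexp c (- k)
           * (s * exp w * qexp c k * jterm c s w (k - 1)))
    with ((s * s) * (exp (- w) * exp w) * (qexp c (- k) * qexp c k)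
          * jterm c s w (k - 1)) by ring.
  rewrite H1, H2, H3. ring.
Qed.

Lemma Rabs_powerRZ_sign (s : R) (k : Z) : Rabs s = 1 -> Rabs (powerRZ s k) = 1.
Proof.
  intros Hs. destruct k; simpl; rewrite ?Rabs_R1; try reflexivity.
  - rewrite <- RPow_abs, Hs. apply pow1.
  - rewrite Rabs_inv, <- RPow_abs, Hs, pow1. apply Rinv_1.
Qed.

(** The growth condition admits the weight 1 of the triple product and the weight k of its
    derivative, together with their shifts. *)
Lemma zsummable_jterm (a : Z -> R) (c s w : R) :
  0 < c -> Rabs s = 1 -> (forall k, Rabs (a k) <= 1 + Rabs (IZR k)) ->
  zsummable (fun k => a k * jterm c s w k).
Proof.
  (* Completing the square: k w - c k (k + 1) = c v^2 - c (k + v)^2. *)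
  intros Hc Hs Ha. set (v := 1 / 2 - w / (2 * c)).
  apply zsummable_gauss with ((1 + Rabs v) * exp (c * v ^ 2)) c v; [exact Hc| |].
  - apply Rmult_lt_0_compat; [|apply exp_pos]. assert (H := Rabs_pos v). lra.
  - intros k. rewrite Rabs_mult. unfold jterm.
    rewrite Rabs_mult, Rabs_powerRZ_sign, Rmult_1_l by exact Hs.
    rewrite (Rabs_pos_eq (exp _)) by apply Rlt_le, exp_pos.
    replace (exp (IZR k * w - c * (IZR k * (IZR k + 1))))
      with (exp (c * v ^ 2) * exp (- c * (IZR k + v) ^ 2))
      by (rewrite <- exp_plus; f_equal; unfold v; field; lra).
    replace ((1 + Rabs v) * exp (c * v ^ 2)
             * ((1 + 2 * Rabs (IZR k + v)) * exp (- c * (IZR k + v) ^ 2)))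
      with ((1 + Rabs v) * (1 + 2 * Rabs (IZR k + v))
             * (exp (c * v ^ 2) * exp (- c * (IZR k + v) ^ 2))) by ring.
    apply Rmult_le_compat_r.
    + apply Rlt_le, Rmult_lt_0_compat; apply exp_pos.
    + eapply Rle_trans; [apply Ha|].
      assert (H := Rabs_triang (IZR k + v) (- v)).
      replace (IZR k + v + - v) with (IZR k) in H by ring.
      rewrite Rabs_Ropp in H.
      assert (H1 := Rabs_pos (IZR k + v)). assert (H2 := Rabs_pos v). nra.
Qed.

Lemma zsummable_mult_bounded (a b : Z -> R) (M : R) :
  (forall k, Rabs (b k) <= M) -> zsummable a -> zsummable (fun k => a k * b k).
Proof.
  intros Hb Ha. apply zsummable_le with (fun k => M * a k).
  - intros k. rewrite !Rabs_mult, Rmult_comm.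
    apply Rmult_le_compat_r; [apply Rabs_pos|].
    eapply Rle_trans; [apply Hb|apply Rle_abs].
  - now apply zsummable_scal.
Qed.

Lemma zsummable_jterm_qbinom (a : Z -> R) (c s w : R) (N : nat) :
  0 < c -> Rabs s = 1 -> (forall k, Rabs (a k) <= 1 + Rabs (IZR k)) ->
  zsummable (fun k => a k * jterm c s w k * qbinom c N k).
Proof.
  intros Hc Hs Ha. destruct (qbinom_bound c Hc) as [M [_ HM]].
  apply (zsummable_mult_bounded _ _ M); [apply HM|].
  now apply zsummable_jterm.
Qed.

(** After [qbinom_rec], re-indexing the two outer sums moves the shift from [qbinom] to the weight
    and to [jterm]. The powers of p combine into factors independent of k, which therefore leave the
    sum. *)
Lemma zseries_jterm_rec (a : Z -> R) (c s w : R) (N : nat) :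
  0 < c -> Rabs s = 1 ->
  (forall k, Rabs (a k) <= 1 + Rabs (IZR k)) ->
  (forall k, Rabs (a (k + 1)%Z) <= 1 + Rabs (IZR k)) ->
  (forall k, Rabs (a (k - 1)%Z) <= 1 + Rabs (IZR k)) ->
  let n := Z.of_nat N in
  let F b := zseries (fun k => b k * jterm c s w k * qbinom c N k) in
  zseries (fun k => a k * jterm c s w k * qbinom c (S N) k) =
    (1 + qexp c (2 * n + 1)) * F a
    + s * exp w * qexp c (n + 1) * F (fun k => a (k + 1)%Z)
    + s * exp (- w) * qexp c n * F (fun k => a (k - 1)%Z).
Proof.
  intros Hc Hs H0 H1 H2 n F. unfold F.
  assert (S0 := zsummable_jterm_qbinom a c s w N Hc Hs H0).
  assert (S1 := zsummable_jterm_qbinom (fun k => a (k + 1)%Z) c s w N Hc Hs H1).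
  assert (S2 := zsummable_jterm_qbinom (fun k => a (k - 1)%Z) c s w N Hc Hs H2).
  set (f0 := fun k : Z => _) in S0. set (f1 := fun k : Z => _) in S1.
  set (f2 := fun k : Z => _) in S2. fold f0 f1 f2.
  rewrite <- (zseries_pred f1 S1), <- (zseries_succ f2 S2), <- !zseries_scal.
  apply zsummable_pred in S1. apply zsummable_succ in S2.
  rewrite <- !zseries_plus;
    try (repeat apply zsummable_plus; apply zsummable_scal; assumption).
  apply zseries_ext. intros k. unfold f0, f1, f2.
  replace (k - 1 + 1)%Z with k by ring. replace (k + 1 - 1)%Z with k by ring.
  rewrite (qbinom_rec c N k Hc), (jterm_pred c s w k Hs), (jterm_succ c s w k Hs).
  fold n.
  assert (E1 : s * exp w * qexp c (n + 1) * (s * exp (- w) * qexp c (- k))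
               = qexp c (n + 1 - k)).
  { replace (s * exp w * qexp c (n + 1) * (s * exp (- w) * qexp c (- k)))
      with ((s * s) * (exp w * exp (- w)) * (qexp c (n + 1) * qexp c (- k))) by ring.
    rewrite (sign_sqr s Hs), <- exp_plus, Rplus_opp_r, exp_0, <- qexp_plus.
    rewrite !Rmult_1_l. reflexivity. }
  assert (E2 : s * exp (- w) * qexp c n * (s * exp w * qexp c (k + 1))
               = qexp c (n + 1 + k)).
  { replace (s * exp (- w) * qexp c n * (s * exp w * qexp c (k + 1)))
      with ((s * s) * (exp (- w) * exp w) * (qexp c n * qexp c (k + 1))) by ring.
    rewrite (sign_sqr s Hs), <- exp_plus, Rplus_opp_l, exp_0, <- qexp_plus.
    rewrite !Rmult_1_l. f_equal. ring. }
  rewrite <- E1, <- E2. ring.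
Qed.

Lemma zseries_jterm_qbinom_0 (a : Z -> R) (c s w : R) :
  0 < c -> zseries (fun k => a k * jterm c s w k * qbinom c 0 k) = a 0%Z.
Proof.
  intros Hc. rewrite <- (zseries_dirac (a 0%Z)). apply zseries_ext. intros k.
  unfold qbinom, qpoch_inv.
  destruct (Z.eqb_spec k 0) as [->|H].
  - unfold jterm. simpl. rewrite !Rmult_0_l, Rmult_0_r, Rminus_0_r, exp_0. field.
  - simpl. destruct (Z.ltb_spec k 0), (Z.ltb_spec (- k) 0); try lia; ring.
Qed.

(** As s * s = 1, [s * exp (- w)] is 1 / z. The first pair contains 1 + 1 / z, so every nonempty
    product vanishes at z = -1. *)
Fixpoint jprod (c s w : R) (N : nat) : R :=
  match N with
  | O => 1
  | S n => jprod c s w n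
           * ((1 + s * exp w * qexp c (Z.of_nat n + 1))
              * (1 + s * exp (- w) * qexp c (Z.of_nat n)))
  end.

Lemma qexp_odd (c : R) (n : Z) : qexp c (2 * n + 1) = qexp c (n + 1) * qexp c n.
Proof.
  rewrite <- qexp_plus. f_equal. ring.
Qed.

Lemma finite_triple_product (c s w : R) (N : nat) :
  0 < c -> Rabs s = 1 ->
  zseries (fun k => 1 * jterm c s w k * qbinom c N k) = jprod c s w N.
Proof.
  intros Hc Hs. induction N as [|N IH].
  - now apply (zseries_jterm_qbinom_0 (fun _ => 1)).
  - assert (H : forall k, Rabs 1 <= 1 + Rabs (IZR k))
      by (intros k; rewrite Rabs_R1; assert (H := Rabs_pos (IZR k)); lra).
    rewrite (zseries_jterm_rec (fun _ => 1)) by auto.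
    rewrite IH, qexp_odd. simpl jprod.
    assert (E : s * exp w * (s * exp (- w)) = 1).
    { replace (s * exp w * (s * exp (- w))) with (s * s * (exp w * exp (- w))) by ring.
      rewrite (sign_sqr s Hs), <- exp_plus, Rplus_opp_r, exp_0. ring. }
    set (A := s * exp w) in *. set (B := s * exp (- w)) in *.
    set (q1 := qexp c (Z.of_nat N + 1)). set (q0 := qexp c (Z.of_nat N)).
    replace ((1 + A * q1) * (1 + B * q0))
      with (1 + A * q1 + B * q0 + (A * B) * q1 * q0) by ring.
    rewrite E. ring.
Qed.

(** This is z d/dz of the finite product at its zero z = -1. Only the factor 1 + 1 / z has to be
    differentiated and contributes 1; the remaining factors are the 1 - p^j with j <= N + 1 and with
    j <= N. *)
Lemma finite_triple_product_deriv (c : R) (N : nat) :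
  0 < c ->
  zseries (fun k => IZR k * jterm c (- 1) 0 k * qbinom c (S N) k)
  = qpoch c N * qpoch c (S N).
Proof.
  intros Hc.
  assert (Hs : Rabs (- 1) = 1) by (rewrite Rabs_left; lra).
  assert (H0 : forall k, Rabs (IZR k) <= 1 + Rabs (IZR k)) by (intros k; lra).
  assert (H1 : forall k, Rabs (IZR (k + 1)) <= 1 + Rabs (IZR k)).
  { intros k. rewrite plus_IZR. assert (H := Rabs_triang (IZR k) 1).
    rewrite Rabs_R1 in H. lra. }
  assert (H2 : forall k, Rabs (IZR (k - 1)) <= 1 + Rabs (IZR k)).
  { intros k. rewrite minus_IZR. assert (H := Rabs_triang (IZR k) (- 1)).
    rewrite Hs in H. replace (IZR k - 1) with (IZR k + - 1) by ring. lra. }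
  assert (H3 : forall k, Rabs 1 <= 1 + Rabs (IZR k))
    by (intros k; rewrite Rabs_R1; assert (H := Rabs_pos (IZR k)); lra).
  (* The shifted weights k + 1 and k - 1 split into the weight k and the weight 1. The latter gives
     [jprod], which is 1 for M = 0 and 0 afterwards. *)
  assert (Hrec : forall M,
    let U := zseries (fun k => IZR k * jterm c (- 1) 0 k * qbinom c M k) in
    zseries (fun k => IZR k * jterm c (- 1) 0 k * qbinom c (S M) k)
    = U * ((1 - qexp c (Z.of_nat M + 1)) * (1 - qexp c (Z.of_nat M)))
      + jprod c (- 1) 0 M * (qexp c (Z.of_nat M) - qexp c (Z.of_nat M + 1))).
  { intros M U. rewrite zseries_jterm_rec by auto. fold U.
    assert (SU := zsummable_jterm_qbinom IZR c (- 1) 0 M Hc Hs H0).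
    assert (SV := zsummable_jterm_qbinom (fun _ => 1) c (- 1) 0 M Hc Hs H3).
    rewrite (zseries_ext (fun k => IZR (k + 1) * _ * _)
      (fun k => IZR k * jterm c (- 1) 0 k * qbinom c M k
                + 1 * jterm c (- 1) 0 k * qbinom c M k))
      by (intros k; rewrite plus_IZR; ring).
    rewrite (zseries_ext (fun k => IZR (k - 1) * _ * _)
      (fun k => IZR k * jterm c (- 1) 0 k * qbinom c M k
                - 1 * jterm c (- 1) 0 k * qbinom c M k))
      by (intros k; rewrite minus_IZR; ring).
    rewrite zseries_plus, zseries_minus by assumption. fold U.
    rewrite finite_triple_product, qexp_odd, Ropp_0, exp_0 by assumption. ring. }
  assert (Hj : forall M, jprod c (- 1) 0 (S M) = 0).
  { induction M as [|M IH].
    - simpl. rewrite Ropp_0, exp_0. unfold qexp at 2.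
      rewrite Rmult_0_r, exp_0. ring.
    - change (jprod c (- 1) 0 (S M)
              * ((1 + -1 * exp 0 * qexp c (Z.of_nat (S M) + 1))
                 * (1 + -1 * exp (- 0) * qexp c (Z.of_nat (S M)))) = 0).
      rewrite IH. ring. }
  assert (HS : forall M, qpoch c (S M) = qpoch c M * (1 - qexp c (Z.of_nat M + 1))).
  { intros M. replace (Z.of_nat M + 1)%Z with (Z.of_nat (S M)) by lia. reflexivity. }
  induction N as [|N IH].
  - rewrite Hrec, zseries_jterm_qbinom_0, HS by assumption. simpl.
    replace (qexp c 0) with 1; [ring|].
    unfold qexp. now rewrite Rmult_0_r, exp_0.
  - rewrite Hrec, IH, Hj, (HS (S N)).
    rewrite (HS N) at 2.
    replace (Z.of_nat (S N)) with (Z.of_nat N + 1)%Z by lia. rewrite (HS N). ring.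
Qed.

Lemma zseries_jterm_qbinom_lim (a : Z -> R) (c s w : R) :
  0 < c -> Rabs s = 1 -> (forall k, Rabs (a k) <= 1 + Rabs (IZR k)) ->
  is_lim_seq (fun N => zseries (fun k => a k * jterm c s w k * qbinom c N k))
    (zseries (fun k => a k * jterm c s w k) / qpoch_inf c).
Proof.
  intros Hc Hs Ha. destruct (qbinom_bound c Hc) as [M [HM Hb]].
  unfold Rdiv. rewrite Rmult_comm, <- zseries_scal.
  rewrite (zseries_ext (fun k => / qpoch_inf c * _)
             (fun k => a k * jterm c s w k * / qpoch_inf c)) by (intros; ring).
  apply zseries_tannery with (fun k => M * (a k * jterm c s w k)).
  - intros N k. rewrite !(Rabs_mult _ (qbinom _ _ _)), (Rabs_mult M), (Rmult_comm (Rabs M)).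
    apply Rmult_le_compat_l; [apply Rabs_pos|].
    eapply Rle_trans; [apply Hb|apply Rle_abs].
  - now apply zsummable_scal, zsummable_jterm.
  - intros k. apply is_lim_seq_mult'; [apply is_lim_seq_const|now apply qbinom_lim].
Qed.

(** Stated as a limit, so that several such products can be multiplied and simplified at finite
    N. *)
Theorem jacobi_triple_product (c s w : R) :
  0 < c -> Rabs s = 1 ->
  is_lim_seq (fun N => qpoch c N * jprod c s w N) (zseries (jterm c s w)).
Proof.
  intros Hc Hs. assert (Hp := qpoch_inf_pos c Hc).
  replace (zseries (jterm c s w))
    with (qpoch_inf c * (zseries (fun k => 1 * jterm c s w k) / qpoch_inf c)).
  - apply is_lim_seq_mult'; [now apply qpoch_lim|].
    apply is_lim_seq_ext with
      (fun N => zseries (fun k => 1 * jterm c s w k * qbinom c N k)).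
    + intros N. now apply finite_triple_product.
    + apply (zseries_jterm_qbinom_lim (fun _ => 1)); [exact Hc|exact Hs|].
      intros k. rewrite Rabs_R1. assert (H := Rabs_pos (IZR k)). lra.
  - rewrite (zseries_ext _ (jterm c s w)) by (intros; ring). field. lra.
Qed.

(** Two factors come from the limit of [qpoch c N * qpoch c (S N)], the third from the limit 1 / (p;
    p)_inf of the central binomials. *)
Theorem jacobi_cube_identity (c : R) :
  0 < c ->
  zseries (fun k => IZR k * jterm c (- 1) 0 k) = qpoch_inf c ^ 3.
Proof.
  intros Hc. assert (Hp := qpoch_inf_pos c Hc).
  assert (Hs : Rabs (- 1) = 1) by (rewrite Rabs_left; lra).
  assert (H := zseries_jterm_qbinom_lim IZR c (- 1) 0 Hc Hs ltac:(intros; lra)).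
  apply is_lim_seq_incr_1 in H.
  assert (H' : is_lim_seq (fun N => qpoch c N * qpoch c (S N))
                 (qpoch_inf c * qpoch_inf c)).
  { apply is_lim_seq_mult'; [now apply qpoch_lim|].
    apply (is_lim_seq_incr_1 (qpoch c)). now apply qpoch_lim. }
  apply (is_lim_seq_ext _ (fun N => qpoch c N * qpoch c (S N))) in H;
    [|intros N; now apply finite_triple_product_deriv].
  assert (E := is_lim_seq_unique _ _ H). rewrite (is_lim_seq_unique _ _ H') in E.
  injection E as E. replace (qpoch_inf c ^ 3)
    with (qpoch_inf c * qpoch_inf c * qpoch_inf c) by ring.
  rewrite E. field. lra.
Qed.

(** * Product formulas for the theta functions *)

Lemma PIx_pos (x : R) : 0 < x -> 0 < PI * x.
Proof.
  intros Hx. apply Rmult_lt_0_compat; [apply PI_RGT_0|exact Hx].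
Qed.

Lemma theta3_jterm (x : R) : theta3 x = zseries (jterm (PI * x) 1 (PI * x)).
Proof.
  apply zseries_ext. intros k. unfold theta3_term, jterm.
  rewrite powerRZ_R1, Rmult_1_l. f_equal. ring.
Qed.

Lemma theta4_jterm (x : R) : theta4 x = zseries (jterm (PI * x) (- 1) (PI * x)).
Proof.
  apply zseries_ext. intros k. unfold theta4_term, jterm. do 2 f_equal. ring.
Qed.

Lemma zsummable_jterm1 (c s w : R) :
  0 < c -> Rabs s = 1 -> zsummable (jterm c s w).
Proof.
  intros Hc Hs. apply zsummable_ext with (fun k => 1 * jterm c s w k).
  - intros k. ring.
  - apply zsummable_jterm; [exact Hc|exact Hs|].
    intros k. rewrite Rabs_R1. assert (H := Rabs_pos (IZR k)). lra.
Qed.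

(** (k - 1/2)^2 = (k - 1) k + 1/4, which is the exponent of [jterm] shifted by one. *)
Lemma theta2_jterm (x : R) :
  0 < x -> theta2 x = exp (- (PI / 4) * x) * zseries (jterm (PI * x) 1 0).
Proof.
  intros Hx. rewrite <- zseries_scal.
  rewrite <- (zseries_pred (fun k => exp (- (PI / 4) * x) * jterm (PI * x) 1 0 k)).
  - apply zseries_ext. intros k. unfold theta2_term, jterm.
    rewrite powerRZ_R1, Rmult_1_l, <- exp_plus. f_equal.
    rewrite minus_IZR. field.
  - apply zsummable_scal, zsummable_jterm1; [now apply PIx_pos|apply Rabs_R1].
Qed.

Lemma Rabs_m1 : Rabs (-1) = 1.
Proof.
  rewrite Rabs_left; lra.
Qed.

Lemma qexp_0 (c : R) : qexp c 0 = 1.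
Proof.
  unfold qexp. rewrite Rmult_0_r. apply exp_0.
Qed.

Lemma zseries_jterm_m1 (c : R) : 0 < c -> zseries (jterm c (-1) 0) = 0.
Proof.
  intros Hc. assert (H := jacobi_triple_product c (-1) 0 Hc Rabs_m1).
  apply is_lim_seq_incr_1 in H.
  apply (is_lim_seq_ext _ (fun _ => 0)) in H.
  - apply is_lim_seq_unique in H. rewrite Lim_seq_const in H. now injection H.
  - intros N.
    assert (Hj : jprod c (-1) 0 (S N) = 0).
    { induction N as [|N IH].
      - simpl. rewrite Ropp_0, exp_0, qexp_0. ring.
      - change (jprod c (- 1) 0 (S N)
              * ((1 + -1 * exp 0 * qexp c (Z.of_nat (S N) + 1))
                 * (1 + -1 * exp (- 0) * qexp c (Z.of_nat (S N)))) = 0).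
        rewrite IH. ring. }
    rewrite Hj. ring.
Qed.

(** The weight 2k + 1 splits into 2k, handled by the cube identity, and 1, whose sum is the triple
    product at its zero z = -1. *)
Lemma theta1p_product (x : R) :
  0 < x -> theta1p x = 2 * exp (- (PI / 4) * x) * qpoch_inf (PI * x) ^ 3.
Proof.
  intros Hx. assert (Hc := PIx_pos x Hx).
  rewrite <- jacobi_cube_identity by exact Hc.
  transitivity (exp (- (PI / 4) * x) *
    (2 * zseries (fun k => IZR k * jterm (PI * x) (- 1) 0 k)
     + zseries (jterm (PI * x) (-1) 0))).
  - rewrite <- zseries_scal, <- zseries_plus, <- zseries_scal.
    + apply zseries_ext. intros k. unfold theta1p_term, jterm.
      replace (exp (- PI * (IZR k + 1 / 2) ^ 2 * x))
        with (exp (- (PI / 4) * x)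
              * exp (IZR k * 0 - PI * x * (IZR k * (IZR k + 1))))
        by (rewrite <- exp_plus; f_equal; field).
      ring.
    + apply zsummable_scal, zsummable_jterm; [exact Hc|exact Rabs_m1|intros; lra].
    + apply zsummable_jterm1; [exact Hc|exact Rabs_m1].
  - rewrite zseries_jterm_m1 by exact Hc. ring.
Qed.

(* Euler: (1 + q)(1 + q^2)(1 + q^3)... = 1 / ((1 - q)(1 - q^3)(1 - q^5)...) *)
Lemma jprod_euler (c : R) (N : nat) :
  jprod c 1 0 N * jprod c 1 c N * jprod c (-1) c N
    * (1 + qexp c (Z.of_nat N)) * qpoch c N ^ 2
  = 2 * qpoch c (2 * N) ^ 2.
Proof.
  induction N as [|N IH].
  - simpl. rewrite qexp_0. ring.
  - replace (2 * S N)%nat with (S (S (2 * N))) by lia.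
    change (qpoch c (S N)) with (qpoch c N * (1 - qexp c (Z.of_nat (S N)))).
    simpl jprod.
    change (qpoch c (S (S (2 * N))))
      with (qpoch c (2 * N) * (1 - qexp c (Z.of_nat (S (2 * N))))
            * (1 - qexp c (Z.of_nat (S (S (2 * N)))))).
    replace (Z.of_nat (S N)) with (Z.of_nat N + 1)%Z by lia.
    replace (Z.of_nat (S (2 * N))) with (2 * Z.of_nat N + 1)%Z by lia.
    replace (Z.of_nat (S (S (2 * N)))) with ((Z.of_nat N + 1) + (Z.of_nat N + 1))%Z by lia.
    rewrite (qexp_plus c (Z.of_nat N + 1)), Ropp_0, exp_0.
    (* h is the odd power exp (- c (2n + 1)): [theta3] contributes (1 + h)^2 and [theta4]
       contributes (1 - h)^2. *)
    set (n := Z.of_nat N) in *. set (h := exp (- c) * qexp c n).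
    replace (1 * exp (- c) * qexp c n) with h by (unfold h; ring).
    assert (Eh : exp c * qexp c (n + 1) = h).
    { unfold h, qexp. rewrite <- !exp_plus. f_equal. rewrite plus_IZR. ring. }
    replace (1 * exp c * qexp c (n + 1)) with h by (rewrite <- Eh; ring).
    replace (-1 * exp (- c) * qexp c n) with (- h) by (unfold h; ring).
    replace (-1 * exp c * qexp c (n + 1)) with (- h) by (rewrite <- Eh; ring).
    replace (qexp c (2 * n + 1)) with (h * h).
    2:{ unfold h, qexp. rewrite <- !exp_plus. f_equal.
        rewrite plus_IZR, mult_IZR. ring. }
    set (P := qpoch c (2 * N)) in *. set (Q := qpoch c N) in *.
    set (a := qexp c (n + 1)).
    transitivity (jprod c 1 0 N * jprod c 1 c N * jprod c (-1) c N * (1 + qexp c n) * Q ^ 2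
      * ((1 - h * h) ^ 2 * (1 - a * a) ^ 2)); [ring|].
    rewrite IH. ring.
Qed.

Lemma qexp_lim (c : R) : 0 < c -> is_lim_seq (fun N => qexp c (Z.of_nat N)) 0.
Proof.
  intros Hc. apply is_lim_seq_ext with (fun N => qexp c 1 ^ N).
  - induction n as [|n IH].
    + now rewrite qexp_0.
    + replace (Z.of_nat (S n)) with (1 + Z.of_nat n)%Z by lia.
      rewrite qexp_plus. simpl. now rewrite IH.
  - apply is_lim_seq_geom. rewrite Rabs_pos_eq by apply Rlt_le, exp_pos.
    apply qexp_lt1; [exact Hc|lia].
Qed.

Lemma theta_product (x : R) :
  0 < x ->
  theta2 x * theta3 x * theta4 x
  = 2 * exp (- (PI / 4) * x) * qpoch_inf (PI * x) ^ 3.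
Proof.
  intros Hx. assert (Hc := PIx_pos x Hx).
  rewrite theta2_jterm, theta3_jterm, theta4_jterm by exact Hx.
  set (c := PI * x) in *.
  assert (H : is_lim_seq (fun N =>
     (qpoch c N * jprod c 1 0 N) * (qpoch c N * jprod c 1 c N)
     * (qpoch c N * jprod c (-1) c N))
     (zseries (jterm c 1 0) * zseries (jterm c 1 c) * zseries (jterm c (-1) c))).
  { repeat apply is_lim_seq_mult'; apply jacobi_triple_product;
      auto using Rabs_R1, Rabs_m1. }
  (* The factor 1 + p^N left over in [jprod_euler] tends to 1. *)
  assert (H' : is_lim_seq (fun N =>
     2 * qpoch c (2 * N) ^ 2 * qpoch c N * / (1 + qexp c (Z.of_nat N)))
     (2 * qpoch_inf c ^ 2 * qpoch_inf c * / (1 + 0))).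
  { assert (H2 : is_lim_seq (fun N => qpoch c (2 * N)) (qpoch_inf c)).
    { apply (is_lim_seq_subseq (qpoch c) (qpoch_inf c) (fun N => 2 * N)%nat).
      - apply eventually_subseq. intros n. lia.
      - now apply qpoch_lim. }
    repeat apply is_lim_seq_mult'; try apply is_lim_seq_const; try assumption.
    - now apply qpoch_lim.
    - apply (is_lim_seq_inv _ (1 + 0)).
      + apply is_lim_seq_plus'; [apply is_lim_seq_const|now apply qexp_lim].
      + intros E. injection E. lra. }
  apply (is_lim_seq_ext _ (fun N =>
     (qpoch c N * jprod c 1 0 N) * (qpoch c N * jprod c 1 c N)
     * (qpoch c N * jprod c (-1) c N))) in H'.
  - apply is_lim_seq_unique in H, H'. rewrite H in H'. injection H' as E.
    transitivity (exp (- (PI / 4) * x) *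
      (zseries (jterm c 1 0) * zseries (jterm c 1 c) * zseries (jterm c (-1) c)));
      [ring|].
    rewrite E. field.
  - intros N. assert (Hq : 0 < qexp c (Z.of_nat N)) by apply exp_pos.
    rewrite <- jprod_euler. field. lra.
Qed.

Lemma infprod_qpoch (x : R) :
  0 < x ->
  infprod (fun k : nat => (1 - exp (- 2 * INR k * PI * x)) ^ 3)
  = qpoch_inf (PI * x) ^ 3.
Proof.
  intros Hx. assert (Hc := PIx_pos x Hx). unfold infprod.
  rewrite (is_lim_seq_unique _ (Finite (qpoch_inf (PI * x) ^ 3))); [reflexivity|].
  (* [partial_prod] at N has N + 1 factors. *)
  apply is_lim_seq_ext with (fun N => qpoch (PI * x) (S N) ^ 3).
  - intros N. unfold partial_prod.
    assert (Hf : forall k, 1 - exp (- 2 * INR k * PI * x) = 1 - qexp (PI * x) (Z.of_nat k)).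
    { intros k. unfold qexp. do 2 f_equal. rewrite <- INR_IZR_INZ. ring. }
    induction N as [|N IH].
    + change (qpoch (PI * x) 1 ^ 3 = (1 - exp (- 2 * INR 1 * PI * x)) ^ 3).
      rewrite (Hf 1%nat). simpl. ring.
    + change (qpoch (PI * x) (S (S N)))
        with (qpoch (PI * x) (S N) * (1 - qexp (PI * x) (Z.of_nat (S (S N))))).
      change (prod_f_R0 (fun n => (1 - exp (- 2 * INR (S n) * PI * x)) ^ 3) (S N))
        with (prod_f_R0 (fun n => (1 - exp (- 2 * INR (S n) * PI * x)) ^ 3) N
              * (1 - exp (- 2 * INR (S (S N)) * PI * x)) ^ 3).
      rewrite <- IH, Hf. ring.
  - assert (H : is_lim_seq (fun N => qpoch (PI * x) (S N)) (qpoch_inf (PI * x)))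
      by (apply (is_lim_seq_incr_1 (qpoch (PI * x))); now apply qpoch_lim).
    simpl. repeat apply is_lim_seq_mult'; try exact H. apply is_lim_seq_const.
Qed.

(** * Power sums of cosines and central binomials *)

(** The convention 1 / m! = 0 for m < 0 makes [fact_inv_pred] hold for every integer, as [qpoch_inv]
    does in the q-case. *)
Definition fact_inv (m : Z) : R :=
  if (m <? 0)%Z then 0 else / INR (fact (Z.to_nat m)).

(* 4^(-m) times the binomial coefficient (2m choose m + j), zero for |j| > m. *)
Definition cbinom (m : nat) (j : Z) : R :=
  INR (fact (2 * m)) / 4 ^ m * fact_inv (Z.of_nat m + j) * fact_inv (Z.of_nat m - j).

Lemma fact_inv_pred (m : Z) : fact_inv (m - 1) = IZR m * fact_inv m.
Proof.
  unfold fact_inv.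
  destruct (Z.ltb_spec (m - 1) 0), (Z.ltb_spec m 0); try lia; [ring| |].
  - replace m with 0%Z by lia. simpl. ring.
  - destruct (Z_of_nat_complete m ltac:(lia)) as [[|n] ->]; [lia|].
    replace (Z.of_nat (S n) - 1)%Z with (Z.of_nat n) by lia. rewrite !Nat2Z.id.
    change (fact (S n)) with (S n * fact n)%nat.
    rewrite mult_INR, <- INR_IZR_INZ. field.
    split; [apply INR_fact_neq_0|apply not_0_INR; lia].
Qed.

Lemma fact_inv_nonneg (m : Z) : 0 <= fact_inv m.
Proof.
  unfold fact_inv. destruct (_ <? _)%Z; [lra|].
  apply Rlt_le, Rinv_0_lt_compat, INR_fact_lt_0.
Qed.

Lemma cbinom_nonneg (m : nat) (j : Z) : 0 <= cbinom m j.
Proof.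
  unfold cbinom. repeat apply Rmult_le_pos; try apply fact_inv_nonneg.
  - apply pos_INR.
  - apply Rlt_le, Rinv_0_lt_compat, pow_lt. lra.
Qed.

Lemma cbinom_0_pos (m : nat) : 0 < cbinom m 0.
Proof.
  unfold cbinom, fact_inv. rewrite Z.add_0_r, Z.sub_0_r.
  destruct (Z.ltb_spec (Z.of_nat m) 0); [lia|].
  repeat apply Rmult_lt_0_compat; try apply Rinv_0_lt_compat;
    try apply INR_fact_lt_0. apply pow_lt. lra.
Qed.

Lemma fact_2S (m : nat) :
  INR (fact (2 * S m)) = (2 * INR m + 2) * (2 * INR m + 1) * INR (fact (2 * m)).
Proof.
  replace (2 * S m)%nat with (S (S (2 * m))) by lia.
  change (fact (S (S (2 * m)))) with (S (S (2 * m)) * (S (2 * m) * fact (2 * m)))%nat.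
  rewrite !mult_INR, !S_INR, mult_INR. simpl (INR 2). ring.
Qed.

(** [cbinom m] is the law of a random walk after m steps -1, 0, 1 with probabilities 1/4, 1/2, 1/4;
    this explains the later names [walk_length] and [diffusion]. *)
Lemma cbinom_rec (m : nat) (j : Z) :
  cbinom (S m) j = / 2 * cbinom m j + / 4 * cbinom m (j - 1) + / 4 * cbinom m (j + 1).
Proof.
  unfold cbinom. rewrite fact_2S. set (n := Z.of_nat m).
  replace (Z.of_nat (S m) + j)%Z with (n + 1 + j)%Z by lia.
  replace (Z.of_nat (S m) - j)%Z with (n + 1 - j)%Z by lia.
  replace (n + j)%Z with (n + 1 + j - 1)%Z by lia.
  replace (n - j)%Z with (n + 1 - j - 1)%Z by lia.
  replace (n + (j - 1))%Z with (n + 1 + j - 1 - 1)%Z by lia.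
  replace (n + (j + 1))%Z with (n + 1 + j)%Z by lia.
  replace (n - (j - 1))%Z with (n + 1 - j)%Z by lia.
  replace (n - (j + 1))%Z with (n + 1 - j - 1 - 1)%Z by lia.
  rewrite !fact_inv_pred.
  unfold Z.sub. rewrite !plus_IZR, !opp_IZR. unfold n. rewrite <- INR_IZR_INZ.
  simpl pow. field. apply pow_nonzero. lra.
Qed.

Lemma cbinom_opp (m : nat) (j : Z) : cbinom m (- j) = cbinom m j.
Proof.
  unfold cbinom. replace (Z.of_nat m - - j)%Z with (Z.of_nat m + j)%Z by ring.
  rewrite Z.add_opp_r. ring.
Qed.

Lemma cbinom_succ (m : nat) (j : nat) :
  cbinom m (Z.of_nat (S j)) * (INR m + INR j + 1)
  = cbinom m (Z.of_nat j) * (INR m - INR j).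
Proof.
  unfold cbinom.
  replace (Z.of_nat m + Z.of_nat j)%Z with (Z.of_nat m + Z.of_nat (S j) - 1)%Z by lia.
  replace (Z.of_nat m - Z.of_nat (S j))%Z with (Z.of_nat m - Z.of_nat j - 1)%Z by lia.
  rewrite !fact_inv_pred, minus_IZR, plus_IZR, <- !INR_IZR_INZ, S_INR. ring.
Qed.

(** Consecutive coefficients have the ratio 1 - (2j+1) / (m+j+1), at most exp (- (2j+1) / (m+d))
    while j + 1 <= d. The odd numbers 2j + 1 add up to a square. *)
Lemma cbinom_upper (m d j : nat) :
  (j <= d)%nat -> (d <= m)%nat ->
  cbinom m (Z.of_nat j) <= cbinom m 0 * exp (- (INR j ^ 2 / (INR m + INR d))).
Proof.
  intros Hj Hd. induction j as [|j IH].
  - simpl INR. rewrite pow_i by lia. unfold Rdiv. rewrite Rmult_0_l, Ropp_0, exp_0.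
    simpl Z.of_nat. lra.
  - specialize (IH ltac:(lia)). assert (HS := cbinom_succ m j).
    assert (H0 := cbinom_nonneg m (Z.of_nat j)).
    assert (Hjd := le_INR _ _ Hj). rewrite S_INR in *.
    assert (Hdm := le_INR _ _ Hd). assert (Hj0 := pos_INR j).
    set (mm := INR m) in *. set (dd := INR d) in *. set (jj := INR j) in *.
    assert (E : cbinom m (Z.of_nat (S j))
                = cbinom m (Z.of_nat j) * (1 + - ((2 * jj + 1) / (mm + jj + 1)))).
    { apply Rmult_eq_reg_r with (mm + jj + 1); [|lra]. rewrite HS. field. lra. }
    rewrite E.
    replace (- ((jj + 1) ^ 2 / (mm + dd)))
      with (- (jj ^ 2 / (mm + dd)) + - ((2 * jj + 1) / (mm + dd))) by (field; lra).
    rewrite exp_plus, <- Rmult_assoc.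
    apply Rle_trans with (cbinom m (Z.of_nat j) * exp (- ((2 * jj + 1) / (mm + dd)))).
    + apply Rmult_le_compat_l; [exact H0|].
      eapply Rle_trans; [apply exp_ineq1_le|]. apply exp_incr_le.
      apply Ropp_le_contravar. unfold Rdiv. apply Rmult_le_compat_l; [lra|].
      apply Rinv_le_contravar; lra.
    + apply Rmult_le_compat_r; [apply Rlt_le, exp_pos|exact IH].
Qed.

(** The inverse ratio is 1 + (2j+1) / (m-j), at most exp ((2j+1) / (m-d)). With [cbinom_upper] this
    is a local limit theorem with explicit errors, relative to the central coefficient. *)
Lemma cbinom_lower (m d j : nat) :
  (j <= d)%nat -> (d < m)%nat ->
  cbinom m 0 * exp (- (INR j ^ 2 / (INR m - INR d))) <= cbinom m (Z.of_nat j).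
Proof.
  intros Hj Hd. induction j as [|j IH].
  - simpl INR. rewrite pow_i by lia. unfold Rdiv. rewrite Rmult_0_l, Ropp_0, exp_0.
    simpl Z.of_nat. lra.
  - specialize (IH ltac:(lia)). assert (HS := cbinom_succ m j).
    assert (H0 := cbinom_nonneg m (Z.of_nat j)).
    assert (Hjd := le_INR _ _ Hj). rewrite S_INR in *.
    assert (Hdm := lt_INR _ _ Hd). assert (Hj0 := pos_INR j).
    set (mm := INR m) in *. set (dd := INR d) in *. set (jj := INR j) in *.
    set (v := (2 * jj + 1) / (mm - dd)).
    assert (Hv : (2 * jj + 1) / (mm - jj) <= v).
    { unfold v, Rdiv. apply Rmult_le_compat_l; [lra|].
      apply Rinv_le_contravar; lra. }
    assert (He := exp_ineq1_le v).
    assert (Hi : exp (- v) * exp v = 1)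
      by (rewrite <- exp_plus, Rplus_opp_l; apply exp_0).
    assert (Hp := exp_pos (- v)).
    replace (- ((jj + 1) ^ 2 / (mm - dd)))
      with (- (jj ^ 2 / (mm - dd)) + - v) by (unfold v; field; lra).
    rewrite exp_plus, <- Rmult_assoc.
    apply Rle_trans with (cbinom m (Z.of_nat j) * exp (- v)).
    + apply Rmult_le_compat_r; [apply Rlt_le, exp_pos|exact IH].
    + apply Rmult_le_reg_r with (mm + jj + 1); [lra|]. rewrite HS.
      rewrite Rmult_assoc. apply Rmult_le_compat_l; [exact H0|].
      replace (mm + jj + 1) with ((mm - jj) * (1 + (2 * jj + 1) / (mm - jj)))
        by (field; lra).
      apply Rle_trans with (exp (- v) * ((mm - jj) * exp v)).
      * apply Rmult_le_compat_l; [lra|]. apply Rmult_le_compat_l; lra.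
      * replace (exp (- v) * ((mm - jj) * exp v))
          with ((mm - jj) * (exp (- v) * exp v)) by ring. rewrite Hi. lra.
Qed.

Lemma cbinom_abs (m : nat) (k : Z) : cbinom m k = cbinom m (Z.of_nat (Z.abs_nat k)).
Proof.
  destruct (Z.le_gt_cases 0 k).
  - f_equal. lia.
  - rewrite <- cbinom_opp. f_equal. lia.
Qed.

Lemma INR_abs_nat_sqr (k : Z) : INR (Z.abs_nat k) ^ 2 = IZR k ^ 2.
Proof.
  rewrite INR_IZR_INZ, Nat2Z.inj_abs_nat, abs_IZR. apply pow2_abs.
Qed.

Lemma cbinom_vanish (m : nat) (k : Z) : (Z.of_nat m < Z.abs k)%Z -> cbinom m k = 0.
Proof.
  intros H. unfold cbinom, fact_inv.
  destruct (Z.ltb_spec (Z.of_nat m + k) 0), (Z.ltb_spec (Z.of_nat m - k) 0);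
    try lia; ring.
Qed.

(** [cbinom_upper] with d = m; the added 1 keeps the denominator positive at m = 0. Being valid for
    every k, it provides the domination. *)
Lemma cbinom_gauss (m : nat) (k : Z) :
  cbinom m k <= cbinom m 0 * exp (- (IZR k ^ 2 / (2 * INR m + 1))).
Proof.
  assert (H0 := cbinom_0_pos m).
  destruct (Z.le_gt_cases (Z.abs k) (Z.of_nat m)) as [H|H].
  - rewrite cbinom_abs, <- INR_abs_nat_sqr.
    eapply Rle_trans; [apply (cbinom_upper m m); lia|].
    apply Rmult_le_compat_l; [lra|]. apply exp_incr_le, Ropp_le_contravar.
    destruct m as [|m].
    + replace (Z.abs_nat k) with O by lia. simpl. lra.
    + unfold Rdiv. apply Rmult_le_compat_l; [apply pow2_ge_0|].
      assert (Hm := pos_INR m). rewrite S_INR. apply Rinv_le_contravar; lra.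
  - rewrite cbinom_vanish by lia. apply Rmult_le_pos; [lra|apply Rlt_le, exp_pos].
Qed.

Lemma zsummable_cbinom (m : nat) : zsummable (cbinom m).
Proof.
  assert (Hm := pos_INR m).
  apply zsummable_gauss with (cbinom m 0) (/ (2 * INR m + 1)) 0.
  - apply Rinv_0_lt_compat. lra.
  - apply cbinom_0_pos.
  - intros k. rewrite Rabs_pos_eq by apply cbinom_nonneg.
    eapply Rle_trans; [apply cbinom_gauss|].
    apply Rmult_le_compat_l; [apply Rlt_le, cbinom_0_pos|].
    rewrite Rplus_0_r.
    replace (- / (2 * INR m + 1) * IZR k ^ 2)
      with (- (IZR k ^ 2 / (2 * INR m + 1))) by (unfold Rdiv; ring).
    assert (He := exp_pos (- (IZR k ^ 2 / (2 * INR m + 1)))).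
    assert (Ha := Rabs_pos (IZR k)). nra.
Qed.

Lemma zsummable_cbinom_mult (m : nat) (b : Z -> R) (M : R) :
  (forall k, Rabs (b k) <= M) -> zsummable (fun k => cbinom m k * b k).
Proof.
  intros H. apply (zsummable_mult_bounded _ _ M H), zsummable_cbinom.
Qed.

Lemma Rabs_cos_le1 (u : R) : Rabs (cos u) <= 1.
Proof.
  apply Rabs_le, COS_bound.
Qed.

(** Multiplying cos (2ju) by (cos u)^2 gives cos (2ju) with weight 1/2 and its two neighbours with
    weight 1/4, exactly as in [cbinom_rec]. *)
Lemma cos_pow_even (u : R) (m : nat) :
  cos u ^ (2 * m) = zseries (fun j => cbinom m j * cos (2 * IZR j * u)).
Proof.
  induction m as [|m IH].
  - simpl pow. rewrite <- (zseries_dirac 1) at 1. apply zseries_ext. intros j.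
    destruct (Z.eqb_spec j 0) as [->|H].
    + rewrite Rmult_0_r, Rmult_0_l, cos_0. unfold cbinom, fact_inv. simpl. field.
    + rewrite cbinom_vanish by lia. ring.
  - symmetry.
    (* Writing j - 1 + 1 and j + 1 - 1 makes the outer terms literal shifts, as [zseries_pred] and
       [zseries_succ] require. *)
    rewrite (zseries_ext _ (fun j => / 2 * (cbinom m j * cos (2 * IZR j * u))
      + / 4 * (cbinom m (j - 1) * cos (2 * IZR (j - 1 + 1) * u))
      + / 4 * (cbinom m (j + 1) * cos (2 * IZR (j + 1 - 1) * u)))).
    2:{ intros j. rewrite cbinom_rec. replace (j - 1 + 1)%Z with j by ring.
        replace (j + 1 - 1)%Z with j by ring. ring. }
    assert (S0 := zsummable_cbinom_mult m (fun j => cos (2 * IZR j * u)) 1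
                    ltac:(intros; apply Rabs_cos_le1)).
    assert (S1 := zsummable_cbinom_mult m (fun j => cos (2 * IZR (j + 1) * u)) 1
                    ltac:(intros; apply Rabs_cos_le1)).
    assert (S2 := zsummable_cbinom_mult m (fun j => cos (2 * IZR (j - 1) * u)) 1
                    ltac:(intros; apply Rabs_cos_le1)).
    assert (P1 := zsummable_pred _ S1). assert (P2 := zsummable_succ _ S2).
    cbv beta in P1, P2.
    rewrite !zseries_plus; try (repeat apply zsummable_plus; apply zsummable_scal; assumption).
    rewrite !zseries_scal, (zseries_pred _ S1), (zseries_succ _ S2), <- !zseries_scal.
    rewrite <- !zseries_plus; try (repeat apply zsummable_plus; apply zsummable_scal; assumption).
    replace (2 * S m)%nat with (2 + 2 * m)%nat by lia. rewrite pow_add, IH, <- zseries_scal.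
    apply zseries_ext. intros j. rewrite plus_IZR, minus_IZR.
    replace (2 * (IZR j + 1) * u) with (2 * IZR j * u + 2 * u) by ring.
    replace (2 * (IZR j - 1) * u) with (2 * IZR j * u - 2 * u) by ring.
    rewrite cos_plus, cos_minus, cos_2a_cos. field.
Qed.

Lemma dirichlet_kernel (y : R) (p : nat) :
  sin y * (1 + psum (fun l => 2 * cos (2 * INR (S l) * y)) p)
  = sin ((2 * INR p + 1) * y).
Proof.
  induction p as [|p IH].
  - simpl. rewrite Rplus_0_r, Rmult_1_r. f_equal. ring.
  - rewrite psum_S, <- Rplus_assoc, Rmult_plus_distr_l, IH.
    replace ((2 * INR p + 1) * y) with (2 * INR (S p) * y - y)
      by (rewrite S_INR; ring).
    replace ((2 * INR (S p) + 1) * y) with (2 * INR (S p) * y + y) by ring.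
    rewrite sin_plus, sin_minus. ring.
Qed.

Lemma psum_ext (a b : nat -> R) (n : nat) :
  (forall i, a i = b i) -> psum a n = psum b n.
Proof.
  intros H. induction n as [|n IH]; [reflexivity|]. now rewrite !psum_S, IH, H.
Qed.

Lemma psum_const (c : R) (n : nat) : psum (fun _ => c) n = INR n * c.
Proof.
  induction n as [|n IH]; [simpl; ring|]. rewrite psum_S, IH, S_INR. ring.
Qed.

Lemma cos_2PI_int (k : Z) : cos (2 * IZR k * PI) = 1.
Proof.
  destruct (Z.le_gt_cases 0 k) as [H|H].
  - destruct (Z_of_nat_complete k H) as [n ->].
    rewrite <- INR_IZR_INZ, <- cos_0, <- (cos_period 0 n). f_equal. ring.
  - destruct (Z_of_nat_complete (- k) ltac:(lia)) as [n Hn].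
    rewrite <- cos_neg, <- cos_0, <- (cos_period 0 n). f_equal.
    rewrite INR_IZR_INZ, <- Hn, opp_IZR. ring.
Qed.

(** The sum of the j-th powers of all n-th roots of unity, conjugates paired; n is odd, so only the
    root 1 is unpaired. If n does not divide j, the Dirichlet kernel gives sin (j PI) / sin y =
    0. *)
Lemma root_of_unity_sum (p : nat) (j : Z) :
  let n := (2 * Z.of_nat p + 1)%Z in
  1 + psum (fun l => 2 * cos (2 * IZR j * (INR (S l) * PI / IZR n))) p
  = if (j mod n =? 0)%Z then IZR n else 0.
Proof.
  intros n. set (y := IZR j * PI / IZR n).
  assert (Hn : IZR n <> 0) by (apply eq_IZR_contrapositive; lia).
  assert (HnR : IZR n = 2 * INR p + 1)
    by (unfold n; rewrite plus_IZR, mult_IZR, <- INR_IZR_INZ; reflexivity).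
  rewrite (psum_ext _ (fun l => 2 * cos (2 * INR (S l) * y)))
    by (intros i; do 2 f_equal; unfold y; field; exact Hn).
  destruct (Z.eqb_spec (j mod n) 0) as [E|E].
  - assert (Hj := Z_div_mod_eq_full j n). rewrite E, Z.add_0_r in Hj.
    rewrite (psum_ext _ (fun _ => 2)).
    + rewrite psum_const, HnR. ring.
    + intros i. transitivity (2 * cos (2 * IZR (Z.of_nat (S i) * (j / n)) * PI)).
      * do 2 f_equal. unfold y. rewrite Hj at 1.
        rewrite !mult_IZR, <- INR_IZR_INZ. field. exact Hn.
      * rewrite cos_2PI_int. ring.
  - assert (H := dirichlet_kernel y p). rewrite <- HnR in H.
    replace (IZR n * y) with (IZR j * PI) in H by (unfold y; field; exact Hn).
    rewrite (sin_eq_0_1 (IZR j * PI) (ex_intro _ j eq_refl)) in H.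
    apply Rmult_integral in H. destruct H as [H|H]; [exfalso|exact H].
    apply sin_eq_0_0 in H. destruct H as [k Hk]. apply E.
    assert (Hjk : IZR j = IZR (k * n)).
    { rewrite mult_IZR. apply Rmult_eq_reg_r with (PI / IZR n).
      - replace (IZR j * (PI / IZR n)) with y by (unfold y; field; exact Hn).
        rewrite Hk. field. exact Hn.
      - assert (Hp := PI_RGT_0). unfold Rdiv. apply Rmult_integral_contrapositive.
        split; [lra|now apply Rinv_neq_0_compat]. }
    apply eq_IZR in Hjk. rewrite Hjk. apply Z_mod_mult.
Qed.

(* The finite form of Poisson summation for the Gaussian (Polya). *)
Lemma cos_power_sum (p m : nat) :
  let n := (2 * Z.of_nat p + 1)%Z in
  1 + psum (fun l => 2 * cos (INR (S l) * PI / IZR n) ^ (2 * m)) p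
  = IZR n * zseries (fun k => cbinom m (n * k)).
Proof.
  intros n.
  (* The number q of cosines is separated from the n in the angles to allow induction; the bound M
     gives the summability needed to add the next cosine. *)
  assert (H : forall q,
    (exists M, forall j,
      Rabs (1 + psum (fun l => 2 * cos (2 * IZR j * (INR (S l) * PI / IZR n))) q) <= M) /\
    1 + psum (fun l => 2 * cos (INR (S l) * PI / IZR n) ^ (2 * m)) q
    = zseries (fun j => cbinom m j *
        (1 + psum (fun l => 2 * cos (2 * IZR j * (INR (S l) * PI / IZR n))) q))).
  { induction q as [|q [[M HM] IH]].
    - split; [exists 1; intros j; simpl; rewrite Rplus_0_r, Rabs_R1; lra|].
      transitivity (cos 0 ^ (2 * m)); [rewrite cos_0, pow1; simpl; ring|].
      rewrite cos_pow_even.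
      apply zseries_ext. intros j. simpl psum. rewrite Rmult_0_r, cos_0. ring.
    - split.
      + exists (M + 2). intros j. rewrite psum_S, <- Rplus_assoc.
        eapply Rle_trans; [apply Rabs_triang|]. apply Rplus_le_compat; [apply HM|].
        rewrite Rabs_mult, Rabs_pos_eq by lra.
        assert (H := Rabs_cos_le1 (2 * IZR j * (INR (S q) * PI / IZR n))). lra.
      + rewrite psum_S, <- Rplus_assoc, IH, cos_pow_even, <- zseries_scal.
        rewrite <- zseries_plus.
        * apply zseries_ext. intros j. rewrite psum_S. ring.
        * now apply zsummable_cbinom_mult with M.
        * apply zsummable_scal, zsummable_cbinom_mult with 1. intros; apply Rabs_cos_le1. }
  destruct (H p) as [_ ->]. clear H.
  rewrite <- zseries_on_multiples, <- zseries_scal by (lia || apply zsummable_cbinom).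
  apply zseries_ext. intros j. unfold n. rewrite root_of_unity_sum. fold n.
  unfold on_multiples. destruct (_ =? _)%Z; ring.
Qed.

(** * The modular equation of [theta3] *)

Lemma deriv_nonneg_le (f df : R -> R) (a b : R) :
  a <= b -> (forall x, a <= x <= b -> is_derive f x (df x)) ->
  (forall x, a <= x <= b -> 0 <= df x) -> f a <= f b.
Proof.
  intros Hab Hd Hp.
  destruct (MVT_gen f a b df) as [c [Hc E]];
    rewrite Rmin_left, Rmax_right in * by lra.
  - intros x Hx. apply Hd. lra.
  - intros x Hx. apply continuity_pt_filterlim.
    apply (ex_derive_continuous f x). exists (df x). now apply Hd.
  - specialize (Hp c Hc). nra.
Qed.

Lemma cos_ge_quadratic (u : R) : 0 <= u -> 1 - u ^ 2 / 2 <= cos u.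
Proof.
  intros Hu.
  assert (H : cos 0 + 0 ^ 2 / 2 <= cos u + u ^ 2 / 2).
  { apply (deriv_nonneg_le (fun u => cos u + u ^ 2 / 2) (fun u => u - sin u));
      [exact Hu| |].
    - intros x _. auto_derive; [easy|field].
    - intros x [[Hx|<-] _]; [|rewrite sin_0; lra].
      assert (H := sin_lt_x x Hx). lra. }
  rewrite cos_0 in H. lra.
Qed.

(** cos u * exp (u^2 / 2) decreases because sin u - u cos u >= 0. The range up to PI / 2 covers all
    grid points l PI / (2p + 1) with l <= p. *)
Lemma cos_le_gauss (u : R) : 0 <= u <= PI / 2 -> cos u <= exp (- (u ^ 2 / 2)).
Proof.
  intros Hu. assert (Hpi := PI_RGT_0).
  assert (Ht : forall x, 0 <= x <= u -> 0 <= sin x - x * cos x).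
  { intros x Hx. replace 0 with (sin 0 - 0 * cos 0) by (rewrite sin_0; ring).
    apply (deriv_nonneg_le (fun x => sin x - x * cos x) (fun x => x * sin x)); [lra| |].
    - intros y _. auto_derive; [easy|ring].
    - intros y Hy. apply Rmult_le_pos; [lra|]. apply sin_ge_0; lra. }
  assert (H : - (cos 0 * exp (0 ^ 2 / 2)) <= - (cos u * exp (u ^ 2 / 2))).
  { apply (deriv_nonneg_le (fun u => - (cos u * exp (u ^ 2 / 2)))
      (fun u => exp (u ^ 2 / 2) * (sin u - u * cos u))); [lra| |].
    - intros x _. auto_derive; [easy|]. replace (x * (x * 1) * / 2) with (x ^ 2 / 2) by field.
      field.
    - intros x Hx. apply Rmult_le_pos; [apply Rlt_le, exp_pos|now apply Ht]. }
  rewrite cos_0 in H. replace (0 ^ 2 / 2) with 0 in H by field. rewrite exp_0 in H.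
  apply Rmult_le_reg_r with (exp (u ^ 2 / 2)); [apply exp_pos|].
  rewrite <- exp_plus, Rplus_opp_l, exp_0. lra.
Qed.

Lemma exp_pow (a : R) (n : nat) : exp a ^ n = exp (INR n * a).
Proof.
  induction n as [|n IH].
  - simpl. now rewrite Rmult_0_l, exp_0.
  - simpl pow. rewrite IH, <- exp_plus, S_INR. f_equal. ring.
Qed.

Lemma is_lim_seq_exp (u : nat -> R) (l : R) :
  is_lim_seq u l -> is_lim_seq (fun n => exp (u n)) (exp l).
Proof.
  apply (is_lim_seq_continuous exp). apply derivable_continuous_pt, derivable_pt_exp.
Qed.

Lemma is_lim_seq_opp' (u : nat -> R) (l : R) :
  is_lim_seq u l -> is_lim_seq (fun n => - u n) (- l).
Proof.
  intros H. exact (proj1 (is_lim_seq_opp u l) H).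
Qed.

Lemma is_lim_seq_div_const (u : nat -> R) (a l : R) :
  is_lim_seq u l -> l <> 0 -> is_lim_seq (fun n => a / u n) (a / l).
Proof.
  intros H Hl. apply is_lim_seq_mult'; [apply is_lim_seq_const|].
  apply (is_lim_seq_inv u l H). intros E. injection E. exact Hl.
Qed.

(** * Scaling limits of both sides of the finite identity *)

Definition odd_grid (p : nat) : R := 2 * INR p + 1.

(** [up] rounds strictly upwards, hence [diffusion s p] exceeds s and the limiting Gaussian terms
    already dominate the cosine powers for every p. *)
Definition walk_length (s : R) (p : nat) : nat := Z.to_nat (up (s * odd_grid p ^ 2)).

Definition diffusion (s : R) (p : nat) : R := INR (walk_length s p) / odd_grid p ^ 2.

Lemma odd_grid_ge1 (p : nat) : 1 <= odd_grid p.
Proof.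
  unfold odd_grid. assert (H := pos_INR p). lra.
Qed.

Lemma odd_grid_IZR (p : nat) : IZR (2 * Z.of_nat p + 1) = odd_grid p.
Proof.
  rewrite plus_IZR, mult_IZR, <- INR_IZR_INZ. reflexivity.
Qed.

Lemma walk_length_bounds (s : R) (p : nat) :
  0 < s -> s * odd_grid p ^ 2 < INR (walk_length s p) <= s * odd_grid p ^ 2 + 1.
Proof.
  intros Hs. unfold walk_length. set (y := s * odd_grid p ^ 2).
  assert (Hy : 0 < y).
  { apply Rmult_lt_0_compat; [exact Hs|]. apply pow_lt.
    assert (H := odd_grid_ge1 p). lra. }
  destruct (archimed y) as [H1 H2].
  assert (H0 : (0 < up y)%Z) by (apply lt_IZR; lra).
  rewrite INR_IZR_INZ, Z2Nat.id by lia. lra.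
Qed.

Lemma inv_odd_grid_lim : is_lim_seq (fun p => / odd_grid p) 0.
Proof.
  replace (Finite 0) with (Rbar_inv p_infty) by reflexivity.
  apply is_lim_seq_inv; [|discriminate].
  apply (is_lim_seq_le_p_loc INR); [|apply is_lim_seq_INR].
  exists O. intros p _. unfold odd_grid. assert (H := pos_INR p). lra.
Qed.

Lemma diffusion_bounds (s : R) (p : nat) :
  0 < s -> s < diffusion s p <= s + / odd_grid p ^ 2.
Proof.
  intros Hs. destruct (walk_length_bounds s p Hs) as [H1 H2].
  assert (Hn := odd_grid_ge1 p).
  assert (H0 : 0 < odd_grid p ^ 2) by (apply pow_lt; lra).
  unfold diffusion. split; apply Rmult_lt_reg_r with (odd_grid p ^ 2) ||
    apply Rmult_le_reg_r with (odd_grid p ^ 2); try exact H0.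
  - replace (INR (walk_length s p) / odd_grid p ^ 2 * odd_grid p ^ 2)
      with (INR (walk_length s p)) by (field; lra). exact H1.
  - replace (INR (walk_length s p) / odd_grid p ^ 2 * odd_grid p ^ 2)
      with (INR (walk_length s p)) by (field; lra).
    replace ((s + / odd_grid p ^ 2) * odd_grid p ^ 2)
      with (s * odd_grid p ^ 2 + 1) by (field; lra). exact H2.
Qed.

Lemma inv_odd_grid_sqr_lim : is_lim_seq (fun p => / odd_grid p ^ 2) 0.
Proof.
  apply is_lim_seq_ext with (fun p => / odd_grid p * / odd_grid p).
  - intros p. assert (H := odd_grid_ge1 p). field. lra.
  - rewrite <- (Rmult_0_l 0).
    apply is_lim_seq_mult'; apply inv_odd_grid_lim.
Qed.

Lemma diffusion_lim (s : R) : 0 < s -> is_lim_seq (diffusion s) s.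
Proof.
  intros Hs. apply is_lim_seq_le_le with (fun _ => s) (fun p => s + / odd_grid p ^ 2).
  - intros p. assert (H := diffusion_bounds s p Hs). lra.
  - apply is_lim_seq_const.
  - rewrite <- (Rplus_0_r s) at 1.
    apply is_lim_seq_plus'; [apply is_lim_seq_const|apply inv_odd_grid_sqr_lim].
Qed.

Lemma ex_series_theta3 (x : R) :
  0 < x -> ex_series (fun l => exp (- PI * INR (S l) ^ 2 * x)).
Proof.
  intros Hx. assert (H := zsummable_ex _ (theta3_cv x Hx)). destruct H as [_ H].
  revert H. apply ex_series_ext. intros l. unfold theta3_term.
  rewrite opp_IZR, <- INR_IZR_INZ. f_equal. ring.
Qed.

Lemma theta3_half (x : R) :
  0 < x -> theta3 x = 1 + 2 * Series (fun l => exp (- PI * INR (S l) ^ 2 * x)).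
Proof.
  intros Hx. destruct (zsummable_ex _ (theta3_cv x Hx)) as [H1 _].
  unfold theta3, zseries. rewrite (Series_incr_1 _ H1).
  rewrite (Series_ext (fun k => theta3_term x (Z.of_nat (S k)))
            (fun l => exp (- PI * INR (S l) ^ 2 * x)))
    by (intros l; unfold theta3_term; now rewrite <- INR_IZR_INZ).
  rewrite (Series_ext (fun k => theta3_term x (- Z.of_nat (S k))%Z)
            (fun l => exp (- PI * INR (S l) ^ 2 * x))).
  - unfold theta3_term at 1. simpl IZR. rewrite pow_i, Rmult_0_r, Rmult_0_l, exp_0 by lia.
    ring.
  - intros l. unfold theta3_term. rewrite opp_IZR, <- INR_IZR_INZ. f_equal. ring.
Qed.

(** Turns a sum whose length grows with p into a series, as [series_tannery] requires. *)
Lemma Series_truncated (b : nat -> R) (p : nat) :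
  Series (fun l => if (l <? p)%nat then b l else 0) = psum b p.
Proof.
  apply is_series_unique.
  assert (H : forall q, psum (fun l => if (l <? p)%nat then b l else 0) q
                        = psum b (Nat.min q p)).
  { induction q as [|q IH]; [reflexivity|]. rewrite psum_S, IH.
    destruct (Nat.ltb_spec q p).
    - rewrite !Nat.min_l, psum_S by lia. reflexivity.
    - rewrite !Nat.min_r by lia. ring. }
  change (is_lim_seq (sum_n (fun l => if (l <? p)%nat then b l else 0)) (psum b p)).
  apply is_lim_seq_ext_loc with (fun _ => psum b p).
  - exists p. intros q Hq.
    change (psum b p = psum (fun l => if (l <? p)%nat then b l else 0) (S q)).
    rewrite H. f_equal. lia.
  - apply is_lim_seq_const.
Qed.

(** With u = v / n, cos u lies between 1 - u^2 / 2 and exp (- u^2 / 2) for small u. In the power 2m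
    the exponent 2m u^2 / 2 equals v^2 [diffusion], which tends to v^2 s. *)
Lemma cos_power_lim (s : R) (l : nat) :
  0 < s ->
  is_lim_seq (fun p => cos (INR (S l) * PI / odd_grid p) ^ (2 * walk_length s p))
    (exp (- PI * INR (S l) ^ 2 * (PI * s))).
Proof.
  intros Hs. assert (Hpi := PI_RGT_0). set (v := INR (S l) * PI).
  assert (Hv : 0 < v) by (apply Rmult_lt_0_compat; [apply lt_0_INR; lia|exact Hpi]).
  assert (Hu : is_lim_seq (fun p => v / odd_grid p) 0).
  { rewrite <- (Rmult_0_r v).
    apply is_lim_seq_mult'; [apply is_lim_seq_const|apply inv_odd_grid_lim]. }
  replace (- PI * INR (S l) ^ 2 * (PI * s)) with (- (v ^ 2 * s)) by (unfold v; ring).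
  assert (Hm : forall p, INR (2 * walk_length s p) * ((v / odd_grid p) ^ 2 / 2)
                         = v ^ 2 * diffusion s p).
  { intros p. rewrite mult_INR. simpl (INR 2). unfold diffusion.
    assert (H := odd_grid_ge1 p). field. lra. }
  apply is_lim_seq_le_le_loc with
    (fun p => exp (- (v ^ 2 * diffusion s p / (1 - (v / odd_grid p) ^ 2 / 2))))
    (fun p => exp (- (v ^ 2 * diffusion s p))).
  - assert (He := Hu). apply is_lim_seq_spec in He.
    destruct (He (mkposreal 1 Rlt_0_1)) as [N HN]. exists N. intros p Hp.
    specialize (HN p Hp). simpl in HN. rewrite Rminus_0_r in HN.
    assert (Hn := odd_grid_ge1 p).
    assert (Hu0 : 0 < v / odd_grid p) by (apply Rdiv_lt_0_compat; lra).
    rewrite Rabs_pos_eq in HN by lra. rewrite <- Hm.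
    set (u := v / odd_grid p) in *.
    assert (Hu2 : 0 <= u ^ 2 / 2 <= 1 / 2) by nra.
    assert (Hlow : exp (- (u ^ 2 / 2 / (1 - u ^ 2 / 2))) <= cos u).
    { eapply Rle_trans; [|apply cos_ge_quadratic; lra].
      apply one_minus_ge_exp; lra. }
    assert (Hup : cos u <= exp (- (u ^ 2 / 2))).
    { apply cos_le_gauss. assert (H := PI2_1). lra. }
    split.
    + replace (- (INR (2 * walk_length s p) * (u ^ 2 / 2) / (1 - u ^ 2 / 2)))
        with (INR (2 * walk_length s p) * - (u ^ 2 / 2 / (1 - u ^ 2 / 2)))
        by (field; lra).
      rewrite <- exp_pow. apply pow_incr. split; [apply Rlt_le, exp_pos|exact Hlow].
    + replace (- (INR (2 * walk_length s p) * (u ^ 2 / 2)))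
        with (INR (2 * walk_length s p) * - (u ^ 2 / 2)) by ring.
      rewrite <- exp_pow. apply pow_incr. split; [|exact Hup].
      eapply Rle_trans; [|exact Hlow]. apply Rlt_le, exp_pos.
  - apply is_lim_seq_exp.
    replace (- (v ^ 2 * s)) with (- (v ^ 2 * s / (1 - 0 * 0 / 2))) by field.
    apply is_lim_seq_opp'. apply is_lim_seq_mult'.
    + apply is_lim_seq_mult'; [apply is_lim_seq_const|now apply diffusion_lim].
    + apply (is_lim_seq_inv _ (1 - 0 * 0 / 2)).
      * apply is_lim_seq_minus'; [apply is_lim_seq_const|].
        apply is_lim_seq_mult'; [|apply is_lim_seq_const].
        apply is_lim_seq_ext with (fun p => v / odd_grid p * (v / odd_grid p)).
        -- intros p. simpl. now rewrite Rmult_1_r.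
        -- now apply is_lim_seq_mult'.
      * intros E. injection E. lra.
  - apply is_lim_seq_exp, is_lim_seq_opp'.
    apply is_lim_seq_mult'; [apply is_lim_seq_const|now apply diffusion_lim].
Qed.

Lemma cos_sum_lim (s : R) :
  0 < s ->
  is_lim_seq (fun p => 1 + psum (fun l =>
      2 * cos (INR (S l) * PI / odd_grid p) ^ (2 * walk_length s p)) p)
    (theta3 (PI * s)).
Proof.
  intros Hs. assert (Hpi := PI_RGT_0). rewrite theta3_half by now apply PIx_pos.
  apply is_lim_seq_plus'; [apply is_lim_seq_const|].
  rewrite <- Series_scal_l.
  apply is_lim_seq_ext with (fun p => Series (fun l => if (l <? p)%nat then
      2 * cos (INR (S l) * PI / odd_grid p) ^ (2 * walk_length s p) else 0)).
  { intros p. apply Series_truncated. }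
  apply series_tannery with (fun l => 2 * exp (- PI * INR (S l) ^ 2 * (PI * s))).
  - intros p l. assert (He := exp_pos (- PI * INR (S l) ^ 2 * (PI * s))).
    destruct (Nat.ltb_spec l p) as [H|H]; [|rewrite Rabs_R0; lra].
    set (u := INR (S l) * PI / odd_grid p).
    assert (Hn := odd_grid_ge1 p).
    assert (Hu : 0 <= u <= PI / 2).
    { unfold u. split.
      - apply Rlt_le, Rdiv_lt_0_compat; [|lra].
        apply Rmult_lt_0_compat; [apply lt_0_INR; lia|exact Hpi].
      - apply Rmult_le_reg_r with (odd_grid p); [lra|].
        replace (INR (S l) * PI / odd_grid p * odd_grid p) with (INR (S l) * PI)
          by (field; lra).
        assert (Hl : INR (S l) <= INR p) by (apply le_INR; lia).
        unfold odd_grid. nra. }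
    assert (Hc0 : 0 <= cos u) by (apply cos_ge_0; lra).
    rewrite Rabs_pos_eq by (apply Rmult_le_pos; [lra|now apply pow_le]).
    apply Rmult_le_compat_l; [lra|].
    apply Rle_trans with (exp (- (u ^ 2 / 2)) ^ (2 * walk_length s p)).
    + apply pow_incr. split; [exact Hc0|now apply cos_le_gauss].
    + rewrite exp_pow. apply exp_incr_le. rewrite mult_INR. simpl (INR 2).
      destruct (diffusion_bounds s p Hs) as [Hd _].
      replace ((1 + 1) * INR (walk_length s p) * - (u ^ 2 / 2))
        with (- ((INR (S l) * PI) ^ 2 * diffusion s p))
        by (unfold u, diffusion; field; lra).
      replace (- PI * INR (S l) ^ 2 * (PI * s)) with (- ((INR (S l) * PI) ^ 2 * s)) by ring.
      apply Ropp_le_contravar, Rmult_le_compat_l; [apply pow2_ge_0|lra].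
  - apply (ex_series_scal 2 (fun l => exp (- PI * INR (S l) ^ 2 * (PI * s)))).
    apply ex_series_theta3. now apply PIx_pos.
  - intros l.
    apply is_lim_seq_ext_loc with
      (fun p => 2 * cos (INR (S l) * PI / odd_grid p) ^ (2 * walk_length s p)).
    + exists (S l). intros p Hp. destruct (Nat.ltb_spec l p); [reflexivity|lia].
    + apply is_lim_seq_mult'; [apply is_lim_seq_const|now apply cos_power_lim].
Qed.

Lemma cbinom_grid_abs (s : R) (p : nat) (k : Z) :
  let n := (2 * Z.of_nat p + 1)%Z in
  cbinom (walk_length s p) (n * k)
  = cbinom (walk_length s p) (Z.of_nat ((2 * p + 1) * Z.abs_nat k)).
Proof.
  intros n. rewrite cbinom_abs. f_equal. lia.
Qed.

(** Both binomial bounds are taken with j = d = n |k|. Dividing d^2 and m -+ d by n^2 leaves k^2 /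
    ([diffusion] -+ |k| / n), which tends to k^2 / s. *)
Lemma cbinom_ratio_lim (s : R) (k : Z) :
  0 < s ->
  is_lim_seq (fun p => cbinom (walk_length s p) ((2 * Z.of_nat p + 1) * k)
                       / cbinom (walk_length s p) 0)
    (theta3_term (/ (PI * s)) k).
Proof.
  intros Hs. assert (Hpi := PI_RGT_0). set (j := INR (Z.abs_nat k)).
  assert (Hj : 0 <= j) by apply pos_INR.
  replace (theta3_term (/ (PI * s)) k) with (exp (- (j ^ 2 / s))).
  2:{ unfold theta3_term, j. rewrite INR_abs_nat_sqr. f_equal. field. lra. }
  assert (Hjn : is_lim_seq (fun p => j * / odd_grid p) 0).
  { rewrite <- (Rmult_0_r j).
    apply is_lim_seq_mult'; [apply is_lim_seq_const|apply inv_odd_grid_lim]. }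
  assert (Hd := diffusion_lim s Hs).
  apply is_lim_seq_le_le_loc with
    (fun p => exp (- (j ^ 2 / (diffusion s p - j * / odd_grid p))))
    (fun p => exp (- (j ^ 2 / (diffusion s p + j * / odd_grid p)))).
  - assert (He := Hjn). apply is_lim_seq_spec in He.
    (* Once |k| / n < s one has n |k| < s n^2 < m, as [cbinom_lower] demands. *)
    destruct (He (mkposreal s Hs)) as [N HN]. exists N. intros p Hp.
    specialize (HN p Hp). simpl in HN. rewrite Rminus_0_r in HN.
    assert (Hn := odd_grid_ge1 p).
    rewrite Rabs_pos_eq in HN
      by (apply Rmult_le_pos; [exact Hj|apply Rlt_le, Rinv_0_lt_compat; lra]).
    assert (H0 := cbinom_0_pos (walk_length s p)).
    destruct (walk_length_bounds s p Hs) as [Hw _].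
    rewrite cbinom_grid_abs. set (d := ((2 * p + 1) * Z.abs_nat k)%nat).
    assert (HdR : INR d = odd_grid p * j).
    { unfold d, j, odd_grid. rewrite mult_INR, plus_INR, mult_INR. reflexivity. }
    assert (Hjs : j < s * odd_grid p).
    { apply Rmult_lt_reg_r with (/ odd_grid p); [apply Rinv_0_lt_compat; lra|].
      replace (s * odd_grid p * / odd_grid p) with s by (field; lra). exact HN. }
    assert (Hdw : INR d < INR (walk_length s p)).
    { rewrite HdR. eapply Rlt_trans; [|exact Hw]. nra. }
    assert (Hdw' : (d < walk_length s p)%nat) by now apply INR_lt.
    assert (HwR : INR (walk_length s p) = diffusion s p * odd_grid p ^ 2)
      by (unfold diffusion; field; lra).
    assert (Hds : s < diffusion s p) by (now apply diffusion_bounds).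
    assert (Hjs' : j * / odd_grid p * odd_grid p = j) by (field; lra).
    replace (j ^ 2 / (diffusion s p - j * / odd_grid p))
      with (INR d ^ 2 / (INR (walk_length s p) - INR d)).
    2:{ rewrite HdR, HwR. field. repeat split; nra. }
    replace (j ^ 2 / (diffusion s p + j * / odd_grid p))
      with (INR d ^ 2 / (INR (walk_length s p) + INR d)).
    2:{ rewrite HdR, HwR. field. repeat split; nra. }
    split; apply Rmult_le_reg_l with (cbinom (walk_length s p) 0); try exact H0;
      replace (cbinom (walk_length s p) 0
               * (cbinom (walk_length s p) (Z.of_nat d) / cbinom (walk_length s p) 0))
        with (cbinom (walk_length s p) (Z.of_nat d)) by (field; lra).
    + apply cbinom_lower; lia.
    + apply cbinom_upper; lia.
  - apply is_lim_seq_exp, is_lim_seq_opp'. apply is_lim_seq_div_const; [|lra].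
    rewrite <- (Rminus_0_r s) at 1. now apply is_lim_seq_minus'.
  - apply is_lim_seq_exp, is_lim_seq_opp'. apply is_lim_seq_div_const; [|lra].
    rewrite <- (Rplus_0_r s) at 1. now apply is_lim_seq_plus'.
Qed.

Lemma cbinom_sum_lim (s : R) :
  0 < s ->
  is_lim_seq (fun p =>
      zseries (fun k => cbinom (walk_length s p) ((2 * Z.of_nat p + 1) * k))
      / cbinom (walk_length s p) 0)
    (theta3 (/ (PI * s))).
Proof.
  intros Hs. assert (Hpi := PI_RGT_0).
  apply is_lim_seq_ext with (fun p => zseries (fun k =>
    cbinom (walk_length s p) ((2 * Z.of_nat p + 1) * k) / cbinom (walk_length s p) 0)).
  { intros p. unfold Rdiv. rewrite (Rmult_comm (zseries _)), <- zseries_scal.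
    apply zseries_ext. intros k. ring. }
  (* From m <= s n^2 + 1 and n >= 1: (2m + 1) / n^2 <= 2s + 3 / n^2 <= 2s + 3. *)
  apply zseries_tannery with (theta3_term (/ (PI * (2 * s + 3)))).
  - intros p k. assert (H0 := cbinom_0_pos (walk_length s p)).
    unfold theta3_term. rewrite (Rabs_pos_eq (exp _)) by apply Rlt_le, exp_pos.
    rewrite Rabs_pos_eq
      by (apply Rmult_le_pos; [apply cbinom_nonneg|now apply Rlt_le, Rinv_0_lt_compat]).
    apply Rmult_le_reg_l with (cbinom (walk_length s p) 0); [exact H0|].
    set (b := cbinom _ (_ * k)).
    replace (cbinom (walk_length s p) 0 * (b / cbinom (walk_length s p) 0))
      with b by (field; lra). unfold b.
    eapply Rle_trans; [apply cbinom_gauss|].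
    apply Rmult_le_compat_l; [lra|]. apply exp_incr_le.
    replace (- PI * IZR k ^ 2 * / (PI * (2 * s + 3)))
      with (- (IZR k ^ 2 * / (2 * s + 3))) by (field; lra).
    apply Ropp_le_contravar. rewrite mult_IZR, odd_grid_IZR.
    destruct (walk_length_bounds s p Hs) as [Hw Hw'].
    assert (Hn := odd_grid_ge1 p). assert (Hm := pos_INR (walk_length s p)).
    replace ((odd_grid p * IZR k) ^ 2 / (2 * INR (walk_length s p) + 1))
      with (IZR k ^ 2 * / ((2 * INR (walk_length s p) + 1) / odd_grid p ^ 2))
      by (field; lra).
    apply Rmult_le_compat_l; [apply pow2_ge_0|].
    assert (Hn2 : 1 <= odd_grid p ^ 2) by nra.
    apply Rinv_le_contravar.
    + apply Rdiv_lt_0_compat; lra.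
    + apply Rmult_le_reg_r with (odd_grid p ^ 2); [lra|].
      replace ((2 * INR (walk_length s p) + 1) / odd_grid p ^ 2 * odd_grid p ^ 2)
        with (2 * INR (walk_length s p) + 1) by (field; lra). nra.
  - apply zsummable_ext with (fun k => 1 * theta3_term (/ (PI * (2 * s + 3))) k);
      [intros; ring|].
    apply zsummable_scal. apply theta3_cv, Rinv_0_lt_compat, PIx_pos. lra.
  - intros k. now apply cbinom_ratio_lim.
Qed.

(** * The Wallis sequence and the inversion formula *)

Definition wallis (m : nat) : R := (2 * INR m + 1) * cbinom m 0 ^ 2.

Lemma cbinom_0_succ (m : nat) :
  cbinom (S m) 0 * (2 * INR m + 2) = cbinom m 0 * (2 * INR m + 1).
Proof.
  assert (H := cbinom_succ m 0). simpl (INR 0) in H. simpl (Z.of_nat 1) in H.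
  simpl (Z.of_nat 0) in H. assert (Hm := pos_INR m).
  rewrite cbinom_rec, <- (cbinom_opp m (0 - 1)). simpl (- (0 - 1))%Z. simpl (0 + 1)%Z.
  assert (E : cbinom m 1 = cbinom m 0 * INR m / (INR m + 1))
    by (apply Rmult_eq_reg_r with (INR m + 1); [field_simplify; lra|lra]).
  rewrite E. field. lra.
Qed.

(** Consecutive terms have the ratio (2m+1)(2m+3) / (2m+2)^2 < 1. The limit is 2 / PI, but only its
    existence is needed at this point. *)
Lemma wallis_lim : ex_finite_lim_seq wallis.
Proof.
  apply ex_finite_lim_seq_decr with 0; intros m; unfold wallis.
  - assert (H := cbinom_0_succ m). assert (Hm := pos_INR m). rewrite S_INR.
    assert (E : cbinom (S m) 0 = cbinom m 0 * (2 * INR m + 1) / (2 * INR m + 2))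
      by (rewrite <- H; field; lra).
    rewrite E. assert (Hb := pow2_ge_0 (cbinom m 0)).
    replace ((2 * (INR m + 1) + 1) * (cbinom m 0 * (2 * INR m + 1) / (2 * INR m + 2)) ^ 2)
      with ((2 * INR m + 1) * cbinom m 0 ^ 2
            * ((2 * INR m + 3) * (2 * INR m + 1) / (2 * INR m + 2) ^ 2)) by (field; lra).
    rewrite <- (Rmult_1_r ((2 * INR m + 1) * cbinom m 0 ^ 2)) at 2.
    apply Rmult_le_compat_l; [nra|].
    apply Rmult_le_reg_r with ((2 * INR m + 2) ^ 2); [apply pow_lt; lra|].
    replace ((2 * INR m + 3) * (2 * INR m + 1) / (2 * INR m + 2) ^ 2 * (2 * INR m + 2) ^ 2)
      with ((2 * INR m + 3) * (2 * INR m + 1)) by (field; lra). nra.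
  - apply Rmult_le_pos; [assert (Hm := pos_INR m); lra|apply pow2_ge_0].
Qed.

Lemma walk_length_unbounded (s : R) :
  0 < s -> filterlim (walk_length s) eventually eventually.
Proof.
  intros Hs P [N HN].
  destruct (INR_archimed s (INR N) Hs) as [q Hq]. exists q. intros p Hp.
  apply HN. apply INR_le. destruct (walk_length_bounds s p Hs) as [Hw _].
  assert (Hn := odd_grid_ge1 p). apply le_INR in Hp.
  assert (H0 := pos_INR p). assert (INR p <= odd_grid p) by (unfold odd_grid; lra).
  assert (odd_grid p <= odd_grid p ^ 2) by nra. nra.
Qed.

(** Let b = [cbinom m 0]. The squared finite identity has the factor n^2 b^2 in front of the
    normalised sum squared, and n^2 b^2 = [wallis m] / (2 [diffusion] + 1 / n^2) tends to the Wallis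
    limit over 2s. *)
Lemma theta3_walk (s : R) :
  0 < s ->
  theta3 (PI * s) ^ 2 = real (Lim_seq wallis) / (2 * s) * theta3 (/ (PI * s)) ^ 2.
Proof.
  intros Hs. set (dl := real (Lim_seq wallis)).
  assert (Hw : is_lim_seq wallis dl) by (apply Lim_seq_correct', wallis_lim).
  assert (HL := cos_sum_lim s Hs). assert (HR := cbinom_sum_lim s Hs).
  assert (HL2 := is_lim_seq_mult' _ _ _ _ HL HL).
  assert (H2 : is_lim_seq (fun p => wallis (walk_length s p)
       / (2 * diffusion s p + / odd_grid p ^ 2)) (dl / (2 * s + 0))).
  { apply is_lim_seq_mult'.
    - exact (is_lim_seq_subseq _ _ _ (walk_length_unbounded s Hs) Hw).
    - apply (is_lim_seq_inv _ (2 * s + 0)).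
      + apply is_lim_seq_plus'; [|apply inv_odd_grid_sqr_lim].
        apply is_lim_seq_mult'; [apply is_lim_seq_const|now apply diffusion_lim].
      + intros E. injection E. lra. }
  assert (H3 := is_lim_seq_mult' _ _ _ _ H2 (is_lim_seq_mult' _ _ _ _ HR HR)).
  apply is_lim_seq_unique in HL2.
  eapply is_lim_seq_ext in H3; [apply is_lim_seq_unique in H3; rewrite H3 in HL2|].
  - injection HL2 as E. simpl pow. rewrite !Rmult_1_r, <- E, Rplus_0_r. reflexivity.
  - intros p. cbv beta.
    assert (Hf := cos_power_sum p (walk_length s p)). cbv zeta in Hf.
    rewrite odd_grid_IZR in Hf. rewrite Hf.
    assert (H0 := cbinom_0_pos (walk_length s p)). assert (Hn := odd_grid_ge1 p).
    assert (Hm := pos_INR (walk_length s p)).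
    unfold wallis, diffusion. field. repeat split; nra.
Qed.

Lemma theta3_pos (x : R) : 0 < x -> 0 < theta3 x.
Proof.
  intros Hx. rewrite theta3_half by exact Hx.
  assert (H : 0 * Series (fun _ => 0) <= Series (fun l => exp (- PI * INR (S l) ^ 2 * x))).
  { rewrite <- Series_scal_l. apply Series_le; [|now apply ex_series_theta3].
    intros n. assert (H := exp_pos (- PI * INR (S n) ^ 2 * x)). lra. }
  lra.
Qed.

Theorem theta3_modular (x : R) : 0 < x -> theta3 (/ x) = sqrt x * theta3 x.
Proof.
  intros Hx. assert (Hpi := PI_RGT_0).
  set (dl := real (Lim_seq wallis)).
  assert (H : forall y, 0 < y -> theta3 y ^ 2 = dl / (2 * (y / PI)) * theta3 (/ y) ^ 2).
  { intros y Hy. assert (H := theta3_walk (y / PI) (Rdiv_lt_0_compat _ _ Hy Hpi)).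
    replace (PI * (y / PI)) with y in H by (field; lra). exact H. }
  (* the self-dual point x = 1 determines the Wallis constant *)
  assert (Hdl : dl * PI = 2).
  { assert (H1 := H 1 Rlt_0_1). rewrite Rinv_1 in H1. assert (Hp := theta3_pos 1 Rlt_0_1).
    assert (Hp2 : 0 < theta3 1 ^ 2) by now apply pow_lt.
    replace (dl / (2 * (1 / PI))) with (dl * PI / 2) in H1 by (field; lra). nra. }
  apply Rsqr_inj.
  - apply Rlt_le, theta3_pos. now apply Rinv_0_lt_compat.
  - apply Rmult_le_pos; [apply sqrt_pos|now apply Rlt_le, theta3_pos].
  - rewrite Rsqr_mult, Rsqr_sqrt, !Rsqr_pow2, (H x Hx) by lra.
    replace (dl / (2 * (x / PI))) with (dl * PI / (2 * x)) by (field; lra).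
    rewrite Hdl. field. lra.
Qed.

(** * The function [psi1] *)

Lemma powerRZ_m1_parity (k : Z) :
  powerRZ (-1) k = if (k mod 2 =? 0)%Z then 1 else -1.
Proof.
  assert (H2 : forall m, powerRZ (-1) (2 * m) = 1).
  { intros m. replace (2 * m)%Z with (m + m)%Z by ring. rewrite powerRZ_add by lra.
    apply sign_sqr, Rabs_powerRZ_m1. }
  destruct (Zeven_odd_dec k) as [H|H].
  - destruct (Zeven_ex k H) as [m ->]. rewrite H2, Z.mul_comm, Z_mod_mult. reflexivity.
  - destruct (Zodd_ex k H) as [m ->]. rewrite powerRZ_add, H2, powerRZ_1 by lra.
    replace ((2 * m + 1) mod 2)%Z with 1%Z; [simpl; ring|].
    rewrite Z.add_comm, Z.mul_comm, Z_mod_plus_full. reflexivity.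
Qed.

(** The even-indexed terms of [theta3 x] sum to [theta3 (4 * x)]; twice these minus all terms
    produces the alternating signs. *)
Lemma theta4_theta3 (x : R) : 0 < x -> theta4 x = 2 * theta3 (4 * x) - theta3 x.
Proof.
  intros Hx. assert (Hs : zsummable (theta3_term x)) by now apply theta3_cv.
  assert (E : theta3 (4 * x) = zseries (on_multiples 2 (theta3_term x))).
  { rewrite zseries_on_multiples by (lia || assumption). apply zseries_ext.
    intros k. unfold theta3_term. rewrite mult_IZR. f_equal. ring. }
  rewrite E, <- zseries_scal. unfold theta3.
  rewrite <- zseries_minus; [|apply zsummable_scal; now apply zsummable_on_multiples|exact Hs].
  apply zseries_ext. intros k. unfold theta4_term, on_multiples, theta3_term.
  rewrite powerRZ_m1_parity. destruct (_ =? _)%Z; ring.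
Qed.

(** In [theta3 (x / 4)] the odd indices 2k - 1 give [theta2 x] and the even ones [theta3 x]. *)
Lemma theta2_theta3 (x : R) : 0 < x -> theta2 x = theta3 (x / 4) - theta3 x.
Proof.
  intros Hx. set (a := theta3_term (x / 4)).
  assert (Hs : zsummable a) by (apply theta3_cv; lra).
  assert (E : theta3 x = zseries (on_multiples 2 a)).
  { rewrite zseries_on_multiples by (lia || assumption). apply zseries_ext.
    intros k. unfold a, theta3_term. rewrite mult_IZR. f_equal. field. }
  assert (E2 : theta2 x = zseries (on_multiples 2 (fun j => a (j - 1)%Z))).
  { rewrite zseries_on_multiples; [|lia|now apply zsummable_pred]. apply zseries_ext.
    intros k. unfold a, theta2_term, theta3_term. rewrite minus_IZR, mult_IZR.
    f_equal. field. }
  rewrite E, E2.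
  rewrite <- zseries_succ by now apply zsummable_on_multiples, zsummable_pred.
  change (theta3 (x / 4)) with (zseries a).
  rewrite <- zseries_minus; [|exact Hs|now apply zsummable_on_multiples].
  apply zseries_ext. intros k. unfold on_multiples.
  replace (k + 1 - 1)%Z with k by ring.
  assert (H1 := Z.mod_pos_bound k 2 ltac:(lia)).
  assert (H2 := Z.mod_pos_bound (k + 1) 2 ltac:(lia)).
  assert (H3 := Z_div_mod_eq_full k 2). assert (H4 := Z_div_mod_eq_full (k + 1) 2).
  destruct (Z.eqb_spec (k mod 2) 0), (Z.eqb_spec ((k + 1) mod 2) 0); try lia; ring.
Qed.

Lemma theta2_modular (x : R) : 0 < x -> theta2 (/ x) = sqrt x * theta4 x.
Proof.
  intros Hx. assert (Hi := Rinv_0_lt_compat _ Hx).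
  rewrite theta2_theta3, theta4_theta3 by assumption.
  replace (/ x / 4) with (/ (4 * x)) by (field; lra).
  rewrite !theta3_modular, sqrt_mult by lra.
  replace (sqrt 4) with 2; [ring|].
  replace 4 with (2 * 2) by ring. rewrite sqrt_square; lra.
Qed.

Lemma theta4_modular (x : R) : 0 < x -> theta4 (/ x) = sqrt x * theta2 x.
Proof.
  intros Hx. assert (Hi := Rinv_0_lt_compat _ Hx).
  assert (H := theta2_modular (/ x) Hi). rewrite Rinv_inv in H. rewrite H.
  rewrite <- Rmult_assoc, <- sqrt_mult, Rinv_r, sqrt_1 by lra. ring.
Qed.

Lemma psi1_theta (x : R) :
  0 < x -> psi1 x = Rpower x (3 / 4) * (theta2 x * theta3 x * theta4 x).
Proof.
  intros Hx. unfold psi1. now rewrite theta1p_product, theta_product.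
Qed.

Lemma psi1_qpoch (x : R) :
  0 < x ->
  psi1 x = 2 * Rpower x (3 / 4) * exp (- (PI / 4) * x) * qpoch_inf (PI * x) ^ 3.
Proof.
  intros Hx. unfold psi1. rewrite theta1p_product by exact Hx. ring.
Qed.

Lemma psi1_pos (x : R) : 0 < x -> 0 < psi1 x.
Proof.
  intros Hx. rewrite psi1_qpoch by exact Hx.
  assert (H := qpoch_inf_pos _ (PIx_pos x Hx)).
  repeat apply Rmult_lt_0_compat; try lra; apply exp_pos.
Qed.

(** Inversion exchanges [theta2] and [theta4], and the three factors together yield x^(3/2); the
    exponent 3/4 is half of that. *)
Lemma psi1_inv (x : R) : 0 < x -> psi1 (/ x) = psi1 x.
Proof.
  intros Hx. assert (Hi := Rinv_0_lt_compat _ Hx).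
  rewrite !psi1_theta, theta2_modular, theta3_modular, theta4_modular by assumption.
  assert (E : Rpower (/ x) (3 / 4) * (sqrt x * sqrt x * sqrt x) = Rpower x (3 / 4)).
  { rewrite <- Rpower_sqrt by exact Hx. unfold Rpower. rewrite ln_Rinv by exact Hx.
    rewrite <- !exp_plus. f_equal. field. }
  rewrite <- E. ring.
Qed.

(** * Smoothness on the positive half-line, with explicit derivatives *)

Fixpoint smoothn (n : nat) (f : R -> R) : Prop :=
  match n with
  | O => True
  | S m => exists g, (forall x, 0 < x -> is_derive f x (g x)) /\ smoothn m g
  end.

Lemma locally_pos (x : R) (P : R -> Prop) :
  0 < x -> (forall t, 0 < t -> P t) -> locally x P.
Proof.
  intros Hx H. exists (mkposreal x Hx). intros y Hy. apply H.
  apply Rabs_lt_between' in Hy. simpl in Hy. lra.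
Qed.

Lemma smoothn_ext (n : nat) (f g : R -> R) :
  (forall x, 0 < x -> f x = g x) -> smoothn n f -> smoothn n g.
Proof.
  intros H. destruct n as [|n]; [easy|]. intros [h [Hh Hs]]. exists h.
  split; [|exact Hs]. intros x Hx. apply is_derive_ext_loc with f; [|now apply Hh].
  now apply locally_pos.
Qed.

Lemma smoothn_weaken (n : nat) (f : R -> R) : smoothn (S n) f -> smoothn n f.
Proof.
  revert f. induction n as [|n IH]; [easy|]. intros f [g [Hg Hs]].
  exists g. split; [exact Hg|]. now apply IH.
Qed.

Lemma smoothn_const (n : nat) (c : R) : smoothn n (fun _ => c).
Proof.
  revert c. induction n as [|n IH]; [easy|]. intros c. exists (fun _ => 0).
  split; [|apply IH]. intros x _. auto_derive; easy.
Qed.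

Lemma smoothn_id (n : nat) : smoothn n (fun x => x).
Proof.
  destruct n as [|n]; [easy|]. exists (fun _ => 1).
  split; [|apply smoothn_const]. intros x _. auto_derive; easy.
Qed.

Lemma smoothn_plus (n : nat) (f g : R -> R) :
  smoothn n f -> smoothn n g -> smoothn n (fun x => f x + g x).
Proof.
  revert f g. induction n as [|n IH]; [easy|].
  intros f g [f' [Hf Sf]] [g' [Hg Sg]]. exists (fun x => f' x + g' x).
  split; [|now apply IH]. intros x Hx.
  exact (is_derive_plus f g x _ _ (Hf x Hx) (Hg x Hx)).
Qed.

Lemma smoothn_mult (n : nat) (f g : R -> R) :
  smoothn n f -> smoothn n g -> smoothn n (fun x => f x * g x).
Proof.
  revert f g. induction n as [|n IH]; [easy|].
  intros f g Sf Sg. assert (Wf := smoothn_weaken _ _ Sf).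
  assert (Wg := smoothn_weaken _ _ Sg).
  destruct Sf as [f' [Hf Sf]], Sg as [g' [Hg Sg]].
  exists (fun x => f' x * g x + f x * g' x). split.
  - intros x Hx.
    exact (is_derive_mult f g x _ _ (Hf x Hx) (Hg x Hx) Rmult_comm).
  - apply smoothn_plus; now apply IH.
Qed.

Lemma smoothn_Rpower (n : nat) (a : R) : smoothn n (fun x => Rpower x a).
Proof.
  revert a. induction n as [|n IH]; [easy|]. intros a.
  exists (fun x => a * Rpower x (a - 1)). split.
  - intros x Hx. apply is_derive_Reals. now apply derivable_pt_lim_power.
  - apply smoothn_mult; [apply smoothn_const|apply IH].
Qed.

(** An explicit quadratic remainder lets a series be differentiated termwise with a single summable
    bound. *)
Lemma exp_taylor2 (t : R) : Rabs (exp t - 1 - t) <= t ^ 2 * exp (Rabs t).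
Proof.
  assert (H1 := exp_ineq1_le t). assert (H2 := exp_ineq1_le (- t)).
  assert (Hp := exp_pos t).
  assert (Hi : exp (- t) * exp t = 1) by (rewrite <- exp_plus, Rplus_opp_l; apply exp_0).
  assert (H3 : exp t - 1 <= t * exp t) by nra.
  rewrite Rabs_pos_eq by lra. unfold Rabs. destruct (Rcase_abs t) as [Ht|Ht].
  - assert (H4 : 1 <= exp (- t)) by lra. assert (Ht2 := pow2_ge_0 t).
    assert (exp t - 1 - t <= t ^ 2) by nra. nra.
  - nra.
Qed.

(** General Dirichlet series are closed under differentiation: b becomes - l b. Each half of
    [theta1p] is one. *)
Definition dirichlet (b l : nat -> R) (x : R) : R :=
  Series (fun n => b n * exp (- (l n * x))).

Definition dirichlet_cv (b l : nat -> R) : Prop :=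
  forall d, 0 < d -> ex_series (fun n => Rabs (b n) * exp (- (l n * d))).

(** Half of the exponential absorbs the new factor: l exp (- l d / 2) <= 2 / d, since 1 + t <= exp
    t. *)
Lemma dirichlet_cv_deriv (b l : nat -> R) :
  (forall n, 0 <= l n) -> dirichlet_cv b l -> dirichlet_cv (fun n => - (l n * b n)) l.
Proof.
  intros Hl Hb d Hd.
  apply ex_series_dominated with
    (fun n => 2 / d * (Rabs (b n) * exp (- (l n * (d / 2))))).
  - intros n. rewrite Rabs_Ropp, (Rabs_mult (l n)), (Rabs_pos_eq (l n)) by auto.
    specialize (Hl n). set (e := exp (- (l n * (d / 2)))).
    assert (He : exp (- (l n * d)) = e * e)
      by (unfold e; rewrite <- exp_plus; f_equal; field).
    assert (He0 : 0 < e) by apply exp_pos. rewrite He.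
    assert (Ha := Rabs_pos (b n)).
    rewrite Rabs_pos_eq by (repeat apply Rmult_le_pos; lra).
    assert (H1 := exp_ineq1_le (l n * (d / 2))).
    assert (Hi : e * exp (l n * (d / 2)) = 1)
      by (unfold e; rewrite <- exp_plus, Rplus_opp_l; apply exp_0).
    assert (H2 : l n * e <= 2 / d).
    { apply Rmult_le_reg_r with (d / 2); [lra|].
      replace (2 / d * (d / 2)) with 1 by (field; lra). nra. }
    replace (l n * Rabs (b n) * (e * e)) with (l n * e * (Rabs (b n) * e)) by ring.
    apply Rmult_le_compat_r; [apply Rmult_le_pos; lra|exact H2].
  - apply (ex_series_scal (2 / d) (fun n => Rabs (b n) * exp (- (l n * (d / 2))))).
    apply Hb. lra.
Qed.

Lemma dirichlet_cv_ex (b l : nat -> R) (x : R) :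
  dirichlet_cv b l -> 0 < x -> ex_series (fun n => b n * exp (- (l n * x))).
Proof.
  intros Hb Hx. generalize (Hb x Hx). apply ex_series_dominated.
  intros n. rewrite Rabs_mult, (Rabs_pos_eq (exp _)) by apply Rlt_le, exp_pos. lra.
Qed.

Lemma is_derive_quadratic_bound (f : R -> R) (x l C r : R) :
  0 < r ->
  (forall h, Rabs h < r -> Rabs (f (x + h) - f x - l * h) <= C * h ^ 2) ->
  is_derive f x l.
Proof.
  intros Hr H. apply is_derive_Reals. intros eps He.
  assert (HC : 0 < Rabs C + 1) by (assert (H0 := Rabs_pos C); lra).
  assert (Hd : 0 < Rmin r (eps / (Rabs C + 1)))
    by (apply Rmin_pos; [exact Hr|now apply Rdiv_lt_0_compat]).
  exists (mkposreal _ Hd). intros h Hh0 Hh. simpl in Hh.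
  assert (Hh1 := Rlt_le_trans _ _ _ Hh (Rmin_l _ _)).
  assert (Hh2 := Rlt_le_trans _ _ _ Hh (Rmin_r _ _)).
  specialize (H h Hh1). assert (Hp := Rabs_pos_lt h Hh0).
  replace ((f (x + h) - f x) / h - l) with ((f (x + h) - f x - l * h) * / h)
    by (field; exact Hh0).
  rewrite Rabs_mult, Rabs_inv.
  apply Rmult_lt_reg_r with (Rabs h); [exact Hp|].
  rewrite Rmult_assoc, Rinv_l, Rmult_1_r by lra.
  assert (Hh3 : Rabs h * (Rabs C + 1) < eps).
  { apply Rmult_lt_reg_r with (/ (Rabs C + 1)); [now apply Rinv_0_lt_compat|].
    rewrite Rmult_assoc, Rinv_r, Rmult_1_r by lra. exact Hh2. }
  rewrite <- pow2_abs in H. assert (HCa := Rle_abs C). nra.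
Qed.

Lemma is_derive_dirichlet (b l : nat -> R) (x : R) :
  (forall n, 0 <= l n) -> dirichlet_cv b l -> 0 < x ->
  is_derive (dirichlet b l) x (dirichlet (fun n => - (l n * b n)) l x).
Proof.
  intros Hl Hb Hx.
  assert (Hb1 := dirichlet_cv_deriv b l Hl Hb).
  assert (Hb2 := dirichlet_cv_deriv _ l Hl Hb1).
  (* These are the absolute terms of the second derivative at x / 2: for |h| < x / 2 the remainder
     factor exp (l |h|) costs at most half of exp (- l x). *)
  set (g := fun n => Rabs (- (l n * - (l n * b n))) * exp (- (l n * (x / 2)))).
  assert (Hg : ex_series g) by (apply Hb2; lra).
  apply is_derive_quadratic_bound with (Series g) (x / 2); [lra|].
  intros h Hh. apply Rabs_lt_between in Hh. unfold dirichlet.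
  assert (E0 := dirichlet_cv_ex b l x Hb Hx).
  assert (Eh := dirichlet_cv_ex b l (x + h) Hb ltac:(lra)).
  assert (E1 := dirichlet_cv_ex _ l x Hb1 Hx). cbv beta in E1.
  rewrite (Rmult_comm _ h), <- Series_scal_l.
  rewrite <- (Series_minus _ _ Eh E0).
  rewrite <- Series_minus.
  2:{ exact (ex_series_minus _ _ Eh E0). }
  2:{ exact (ex_series_scal h _ E1). }
  rewrite (Rmult_comm (Series g)), <- Series_scal_l.
  apply series_dominated; [|exact (ex_series_scal (h ^ 2) _ Hg)].
  intros n. unfold g. specialize (Hl n).
  replace (exp (- (l n * (x + h)))) with (exp (- (l n * x)) * exp (- (l n * h)))
    by (rewrite <- exp_plus; f_equal; ring).
  replace (b n * (exp (- (l n * x)) * exp (- (l n * h))) - b n * exp (- (l n * x))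
           - h * (- (l n * b n) * exp (- (l n * x))))
    with (b n * exp (- (l n * x)) * (exp (- (l n * h)) - 1 - - (l n * h))) by ring.
  rewrite !Rabs_mult, (Rabs_pos_eq (exp (- (l n * x)))) by apply Rlt_le, exp_pos.
  rewrite Rabs_Ropp, Rabs_mult, Rabs_Ropp, Rabs_mult, (Rabs_pos_eq (l n)) by exact Hl.
  assert (Ht := exp_taylor2 (- (l n * h))).
  assert (He : exp (- (l n * x)) * exp (Rabs (- (l n * h))) <= exp (- (l n * (x / 2)))).
  { rewrite <- exp_plus. apply exp_incr_le.
    assert (Rabs (- (l n * h)) <= l n * (x / 2)); [|lra].
    rewrite Rabs_Ropp, Rabs_mult, (Rabs_pos_eq (l n)) by exact Hl.
    apply Rmult_le_compat_l; [exact Hl|]. apply Rabs_le. lra. }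
  assert (Hbn := Rabs_pos (b n)). assert (Hx0 := exp_pos (- (l n * x))).
  apply Rle_trans with (Rabs (b n) * exp (- (l n * x))
    * ((- (l n * h)) ^ 2 * exp (Rabs (- (l n * h))))).
  - apply Rmult_le_compat_l; [apply Rmult_le_pos; lra|exact Ht].
  - replace (Rabs (b n) * exp (- (l n * x)) * ((- (l n * h)) ^ 2 * exp (Rabs (- (l n * h)))))
      with (Rabs (b n) * (l n * h) ^ 2 * (exp (- (l n * x)) * exp (Rabs (- (l n * h)))))
      by ring.
    replace (h ^ 2 * (l n * (l n * Rabs (b n)) * exp (- (l n * (x / 2)))))
      with (Rabs (b n) * (l n * h) ^ 2 * exp (- (l n * (x / 2)))) by ring.
    apply Rmult_le_compat_l; [|exact He].
    apply Rmult_le_pos; [lra|apply pow2_ge_0].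
Qed.

Lemma smoothn_dirichlet (n : nat) (b l : nat -> R) :
  (forall n, 0 <= l n) -> dirichlet_cv b l -> smoothn n (dirichlet b l).
Proof.
  intros Hl. revert b. induction n as [|n IH]; [easy|]. intros b Hb.
  exists (dirichlet (fun n => - (l n * b n)) l). split.
  - intros x Hx. now apply is_derive_dirichlet.
  - now apply IH, dirichlet_cv_deriv.
Qed.

Lemma smoothn_theta1p (n : nat) : smoothn n theta1p.
Proof.
  set (b := fun k => powerRZ (-1) k * (2 * IZR k + 1)).
  set (l := fun k => PI * (IZR k + 1 / 2) ^ 2).
  assert (Hl : forall k, 0 <= l k).
  { intros k. apply Rmult_le_pos; [apply Rlt_le, PI_RGT_0|apply pow2_ge_0]. }
  assert (Ht : forall x k, b k * exp (- (l k * x)) = theta1p_term x k).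
  { intros x k. unfold b, l, theta1p_term. do 2 f_equal. ring. }
  apply smoothn_ext with (fun x =>
    dirichlet (fun i => b (Z.of_nat i)) (fun i => l (Z.of_nat i)) x
    + dirichlet (fun i => b (- Z.of_nat (S i))%Z) (fun i => l (- Z.of_nat (S i))%Z) x).
  - intros x Hx. unfold theta1p, zseries, dirichlet.
    f_equal; apply Series_ext; intros i; apply Ht.
  - apply smoothn_plus; apply smoothn_dirichlet; auto;
      intros d Hd; destruct (theta1p_cv d Hd) as [H1 H2];
      [revert H1|revert H2]; apply ex_series_ext; intros i;
      rewrite <- Ht, Rabs_mult, (Rabs_pos_eq (exp _)); auto using Rlt_le, exp_pos.
Qed.

Lemma smoothn_psi1 (n : nat) : smoothn n psi1.
Proof.
  apply smoothn_mult; [apply smoothn_Rpower|apply smoothn_theta1p].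
Qed.

Lemma smoothn_Derive_n (n m : nat) (f : R -> R) :
  smoothn (n + m) f ->
  exists h, (forall x, 0 < x -> Derive_n f n x = h x) /\ smoothn m h.
Proof.
  revert m. induction n as [|n IH]; intros m H.
  - now exists f.
  - destruct (IH (S m)) as [h [Hh [g [Hg Sg]]]].
    + now rewrite Nat.add_succ_r.
    + exists g. split; [|exact Sg]. intros x Hx. simpl.
      apply is_derive_unique. apply is_derive_ext_loc with h; [|now apply Hg].
      apply locally_pos; [exact Hx|]. intros t Ht. symmetry. now apply Hh.
Qed.

Lemma smoothn_smooth (f : R -> R) : (forall n, smoothn n f) -> smooth_on_Rplus f.
Proof.
  intros H [|n] x Hx; [exact I|]. simpl.
  destruct (smoothn_Derive_n n 1 f (H _)) as [h [Hh [g [Hg _]]]].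
  apply ex_derive_ext_loc with h.
  - apply locally_pos; [exact Hx|]. intros t Ht. symmetry. now apply Hh.
  - exists (g x). now apply Hg.
Qed.

Lemma smoothn_ex_derive (f : R -> R) (x : R) :
  smoothn 1 f -> 0 < x -> ex_derive f x.
Proof.
  intros [g [Hg _]] Hx. exists (g x). now apply Hg.
Qed.

(** * The operator D and inversion *)

Lemma smoothn_D (n : nat) (f : R -> R) : smoothn (S n) f -> smoothn n (Defs.D f).
Proof.
  intros [g [Hg Sg]]. apply smoothn_ext with (fun x => x * g x).
  - intros x Hx. unfold Defs.D. f_equal. symmetry. apply is_derive_unique. now apply Hg.
  - apply smoothn_mult; [apply smoothn_id|exact Sg].
Qed.

Lemma smoothn_Diter (k : nat) (f : R -> R) :
  (forall n, smoothn n f) -> forall n, smoothn n (Diter k f).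
Proof.
  intros H. induction k as [|k IH]; [exact H|]. intros n. apply smoothn_D, IH.
Qed.

(** D anticommutes with composition by x -> 1 / x. The general factor c allows iteration with c =
    (-1)^n. *)
Lemma D_reflect (f : R -> R) (c : R) :
  smoothn 1 f -> (forall x, 0 < x -> f x = c * f (/ x)) ->
  forall x, 0 < x -> Defs.D f x = - c * Defs.D f (/ x).
Proof.
  intros Hf H x Hx. assert (Hi := Rinv_0_lt_compat _ Hx).
  assert (Hd : is_derive (fun t => c * f (/ t)) x (c * (- / x ^ 2 * Derive f (/ x)))).
  { assert (He := smoothn_ex_derive f (/ x) Hf Hi).
    auto_derive; [split; [exact He|split; [lra|easy]]|]. change (fun t => f t) with f. field. lra. }
  unfold Defs.D. rewrite (Derive_ext_loc f (fun t => c * f (/ t)))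
    by now apply locally_pos.
  etransitivity; [exact (f_equal (Rmult x) (is_derive_unique _ _ _ Hd))|]. field. lra.
Qed.

Lemma Diter_reflect (f : R -> R) (n : nat) :
  (forall m, smoothn m f) -> (forall x, 0 < x -> f x = f (/ x)) ->
  forall x, 0 < x -> Diter n f x = (-1) ^ n * Diter n f (/ x).
Proof.
  intros Hs H. induction n as [|n IH]; intros x Hx.
  - simpl. rewrite Rmult_1_l. now apply H.
  - change (Defs.D (Diter n f) x = (-1) ^ S n * Defs.D (Diter n f) (/ x)).
    rewrite (D_reflect _ ((-1) ^ n)); [simpl; ring|now apply smoothn_Diter|exact IH|exact Hx].
Qed.

(** * Log-concavity in the variable log x *)

Lemma one_minus_exp_ratio (lam u v : R) :
  1 <= lam -> 0 <= u -> u <= v ->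
  (1 - exp (- (lam * v))) * (1 - exp (- u)) <= (1 - exp (- (lam * u))) * (1 - exp (- v)).
Proof.
  intros Hl Hu Huv.
  assert (HK : 0 <= exp (lam * u) - 1 - lam * (exp u - 1)).
  { replace 0 with (exp (lam * 0) - 1 - lam * (exp 0 - 1))
      by (rewrite Rmult_0_r, exp_0; ring).
    apply (deriv_nonneg_le (fun u => exp (lam * u) - 1 - lam * (exp u - 1))
             (fun u => lam * (exp (lam * u) - exp u))); [exact Hu| |].
    - intros x _. auto_derive; [easy|ring].
    - intros x Hx. assert (H := exp_incr_le x (lam * x) ltac:(nra)). nra. }
  (* H vanishes at u. Its derivative at x >= u is nonnegative if lam (1 - exp (-u)) <= (1 - exp (-
     lam u)) exp ((lam - 1) x); the worst case x = u is [HK]. *)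
  set (H := fun v => (1 - exp (- (lam * u))) * (1 - exp (- v))
                     - (1 - exp (- (lam * v))) * (1 - exp (- u))).
  assert (HH : H u <= H v).
  { apply (deriv_nonneg_le H (fun v => (1 - exp (- (lam * u))) * exp (- v)
               - lam * exp (- (lam * v)) * (1 - exp (- u)))); [exact Huv| |].
    - intros x _. unfold H. auto_derive; [easy|ring].
    - intros x Hx.
      assert (E1 : exp (lam * x) * exp (- (lam * x)) = 1)
        by (rewrite <- exp_plus, Rplus_opp_r; apply exp_0).
      assert (E2 : (1 - exp (- (lam * u))) * exp ((lam - 1) * u)
                   = exp (- u) * (exp (lam * u) - 1)).
      { rewrite Rmult_minus_distr_r, Rmult_minus_distr_l, <- !exp_plus, Rmult_1_l, Rmult_1_r.
        f_equal; [f_equal; ring|]. f_equal. f_equal. ring. }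
      assert (E3 : exp (- u) * exp u = 1)
        by (rewrite <- exp_plus, Rplus_opp_l; apply exp_0).
      assert (H1 : 0 <= 1 - exp (- (lam * u))).
      { assert (H1 := exp_incr_le (- (lam * u)) 0 ltac:(nra)). rewrite exp_0 in H1. lra. }
      assert (H2 := exp_incr_le ((lam - 1) * u) ((lam - 1) * x) ltac:(nra)).
      assert (H3 := exp_pos (- u)). assert (H4 := exp_pos (- (lam * x))).
      assert (H5 : lam * (1 - exp (- u)) <= (1 - exp (- (lam * u))) * exp ((lam - 1) * x)).
      { apply Rle_trans with ((1 - exp (- (lam * u))) * exp ((lam - 1) * u));
          [rewrite E2; nra|]. now apply Rmult_le_compat_l. }
      replace (exp (- x)) with (exp ((lam - 1) * x) * exp (- (lam * x)))
        by (rewrite <- exp_plus; f_equal; ring).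
      nra. }
  unfold H in HH. lra.
Qed.

Lemma qpoch_ratio (lam c d : R) (n : nat) :
  1 <= lam -> 0 < c -> c <= d ->
  qpoch (lam * d) n * qpoch c n <= qpoch (lam * c) n * qpoch d n.
Proof.
  intros Hl Hc Hcd. induction n as [|n IH]; [simpl; lra|].
  set (k := Z.of_nat (S n)).
  assert (Hq : forall x, qpoch x (S n) = qpoch x n * (1 - qexp x k)) by reflexivity.
  rewrite !Hq.
  assert (Hk : 0 < IZR k) by (apply IZR_lt; lia).
  assert (H := one_minus_exp_ratio lam (2 * c * IZR k) (2 * d * IZR k) Hl
                 ltac:(nra) ltac:(nra)).
  replace (exp (- (lam * (2 * d * IZR k)))) with (qexp (lam * d) k) in H
    by (unfold qexp; f_equal; ring).
  replace (exp (- (lam * (2 * c * IZR k)))) with (qexp (lam * c) k) in H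
    by (unfold qexp; f_equal; ring).
  replace (exp (- (2 * d * IZR k))) with (qexp d k) in H
    by (unfold qexp; f_equal; ring).
  replace (exp (- (2 * c * IZR k))) with (qexp c k) in H
    by (unfold qexp; f_equal; ring).
  assert (Hk1 : forall x, 0 < x -> 0 <= 1 - qexp x k).
  { intros x Hx. assert (H1 := qexp_lt1 x k Hx ltac:(lia)). lra. }
  assert (Hp : forall x, 0 < x -> 0 <= qpoch x n) by (intros; now apply Rlt_le, qpoch_pos).
  replace (qpoch (lam * d) n * (1 - qexp (lam * d) k) * (qpoch c n * (1 - qexp c k)))
    with (qpoch (lam * d) n * qpoch c n * ((1 - qexp (lam * d) k) * (1 - qexp c k))) by ring.
  replace (qpoch (lam * c) n * (1 - qexp (lam * c) k) * (qpoch d n * (1 - qexp d k)))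
    with (qpoch (lam * c) n * qpoch d n * ((1 - qexp (lam * c) k) * (1 - qexp d k))) by ring.
  apply Rmult_le_compat; try exact IH; try exact H;
    apply Rmult_le_pos; apply Hp || apply Hk1; nra.
Qed.

Lemma qpoch_inf_ratio (lam c d : R) :
  1 <= lam -> 0 < c -> c <= d ->
  qpoch_inf (lam * d) * qpoch_inf c <= qpoch_inf (lam * c) * qpoch_inf d.
Proof.
  intros Hl Hc Hcd.
  apply (is_lim_seq_le (fun n => qpoch (lam * d) n * qpoch c n)
           (fun n => qpoch (lam * c) n * qpoch d n)
           (qpoch_inf (lam * d) * qpoch_inf c) (qpoch_inf (lam * c) * qpoch_inf d)).
  - intros n. now apply qpoch_ratio.
  - apply is_lim_seq_mult'; apply qpoch_lim; nra.
  - apply is_lim_seq_mult'; apply qpoch_lim; nra.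
Qed.

(* Strict concavity of log psi1 (exp t), as an inequality between increments. *)
Lemma psi1_ratio (lam x y : R) :
  1 <= lam -> 0 < x -> x <= y ->
  psi1 (lam * y) * psi1 x
  <= exp (- (PI / 4) * ((lam - 1) * (y - x))) * (psi1 (lam * x) * psi1 y).
Proof.
  intros Hl Hx Hxy. assert (Hpi := PI_RGT_0).
  assert (Hlx : 0 < lam * x) by nra. assert (Hly : 0 < lam * y) by nra.
  rewrite !psi1_qpoch by lra.
  rewrite <- !Rpower_mult_distr by lra.
  assert (H := qpoch_inf_ratio lam (PI * x) (PI * y) Hl ltac:(nra) ltac:(nra)).
  replace (lam * (PI * x)) with (PI * (lam * x)) in H by ring.
  replace (lam * (PI * y)) with (PI * (lam * y)) in H by ring.
  assert (H1 := qpoch_inf_pos (PI * (lam * y)) ltac:(nra)).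
  assert (H2 := qpoch_inf_pos (PI * x) ltac:(nra)).
  assert (H3 := pow_incr _ _ 3 (conj (Rlt_le _ _ (Rmult_lt_0_compat _ _ H1 H2)) H)).
  set (K := 4 * Rpower lam (3 / 4) * Rpower x (3 / 4) * Rpower y (3 / 4)
            * (exp (- (PI / 4) * (lam * y)) * exp (- (PI / 4) * x))).
  assert (HK : 0 <= K).
  { unfold K, Rpower. repeat apply Rmult_le_pos; try lra; apply Rlt_le, exp_pos. }
  apply (Rmult_le_compat_l _ _ _ HK) in H3. unfold K in H3.
  (* lam y + x = lam x + y + (lam - 1)(y - x); the last term is the source of the strict gap. *)
  assert (E : exp (- (PI / 4) * (lam * y)) * exp (- (PI / 4) * x)
    = exp (- (PI / 4) * ((lam - 1) * (y - x)))
      * (exp (- (PI / 4) * (lam * x)) * exp (- (PI / 4) * y)))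
    by (rewrite <- !exp_plus; f_equal; ring).
  eapply Rle_trans; [eapply Rle_trans; [|exact H3]|].
  - right. ring.
  - rewrite E. right. ring.
Qed.

(** One-sided, because [psi1_ratio] covers only lam >= 1. *)
Lemma right_deriv_nonneg (f : R -> R) (a l : R) :
  is_derive f a l -> f a = 0 -> (forall t, a < t -> 0 <= f t) -> 0 <= l.
Proof.
  intros Hd H0 Hp. apply Rnot_lt_le. intros Hl.
  apply is_derive_Reals in Hd. destruct (Hd (- l) ltac:(lra)) as [d H].
  assert (Hd0 := cond_pos d).
  specialize (H (d / 2) ltac:(lra)). rewrite Rabs_pos_eq in H by lra.
  specialize (H ltac:(lra)). specialize (Hp (a + d / 2) ltac:(lra)).
  rewrite H0, Rminus_0_r in H.
  assert (0 <= f (a + d / 2) / (d / 2))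
    by (apply Rmult_le_pos; [lra|apply Rlt_le, Rinv_0_lt_compat; lra]).
  apply Rabs_lt_between in H. lra.
Qed.

(** * Monotone logarithmic derivative and the maximum *)

Lemma psi1_ex_derive (x : R) : 0 < x -> ex_derive psi1 x.
Proof.
  apply smoothn_ex_derive, smoothn_psi1.
Qed.

(** [psi1_ratio] is an equality at lam = 1, so its right derivative there has a sign. The
    exponential contributes - (PI / 4)(y - x) [psi1 x] [psi1 y], which makes the inequality
    strict. *)
Lemma psi1_log_derivative_decreasing (x y : R) :
  0 < x -> x < y ->
  y * (Derive psi1 y / psi1 y) < x * (Derive psi1 x / psi1 x).
Proof.
  intros Hx Hxy. assert (Hy : 0 < y) by lra. assert (Hpi := PI_RGT_0).
  assert (Px := psi1_pos x Hx). assert (Py := psi1_pos y Hy).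
  set (H := fun lam => exp (- (PI / 4) * ((lam - 1) * (y - x))) * (psi1 (lam * x) * psi1 y)
                       - psi1 (lam * y) * psi1 x).
  assert (Hn : 0 <= - (PI / 4) * (y - x) * (psi1 x * psi1 y)
                    + x * Derive psi1 x * psi1 y - y * Derive psi1 y * psi1 x).
  { apply (right_deriv_nonneg H 1).
    - assert (Ex := psi1_ex_derive x Hx). assert (Ey := psi1_ex_derive y Hy).
      unfold H. auto_derive.
      + rewrite !Rmult_1_l. easy.
      + change (fun t => psi1 t) with psi1.
        rewrite !Rmult_1_l, Rplus_opp_r, Rmult_0_l, Rmult_0_r, exp_0. ring.
    - unfold H. rewrite !Rmult_1_l, Rminus_diag, Rmult_0_l, Rmult_0_r, exp_0. ring.
    - intros t Ht. unfold H. assert (Hr := psi1_ratio t x y ltac:(lra) Hx ltac:(lra)). lra. }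
  apply Rmult_lt_reg_r with (psi1 x * psi1 y); [nra|].
  replace (y * (Derive psi1 y / psi1 y) * (psi1 x * psi1 y))
    with (y * Derive psi1 y * psi1 x) by (field; lra).
  replace (x * (Derive psi1 x / psi1 x) * (psi1 x * psi1 y))
    with (x * Derive psi1 x * psi1 y) by (field; lra).
  assert (Hpos := Rmult_lt_0_compat _ _
    (Rmult_lt_0_compat (PI / 4) (y - x) ltac:(lra) ltac:(lra))
    (Rmult_lt_0_compat _ _ Px Py)).
  lra.
Qed.

(** At the fixed point 1 of the inversion, [D_reflect] with c = 1 says that D psi1 equals its own
    negative. *)
Lemma psi1_Derive_1 : Derive psi1 1 = 0.
Proof.
  assert (H := D_reflect psi1 1 (smoothn_psi1 1)
    ltac:(intros x Hx; rewrite psi1_inv by exact Hx; ring) 1 Rlt_0_1).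
  unfold Defs.D in H. rewrite Rinv_1 in H. lra.
Qed.

Lemma psi1_Derive_pos (c : R) : 0 < c -> c < 1 -> 0 < Derive psi1 c.
Proof.
  intros Hc Hc1. assert (H := psi1_log_derivative_decreasing c 1 Hc Hc1).
  rewrite psi1_Derive_1 in H. unfold Rdiv in H. rewrite Rmult_0_l, Rmult_0_r in H.
  assert (Hi := Rinv_0_lt_compat _ (psi1_pos c Hc)).
  apply Rnot_le_lt. intros Hd.
  assert (0 <= c * (- Derive psi1 c * / psi1 c))
    by (repeat apply Rmult_le_pos; lra). lra.
Qed.

Lemma psi1_lt_max (x : R) : 0 < x -> x <> 1 -> psi1 x < psi1 1.
Proof.
  assert (Hlt : forall x, 0 < x -> x < 1 -> psi1 x < psi1 1).
  { clear x. intros x Hx Hx1.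
    assert (Hd : forall t, x <= t -> is_derive psi1 t (Derive psi1 t))
      by (intros t Ht; apply Derive_correct, psi1_ex_derive; lra).
    (* The derivative vanishes at 1, so strict growth is taken on [x, z], where it is positive
       throughout, and weak growth on [z, 1]. *)
    set (z := (x + 1) / 2). apply Rlt_le_trans with (psi1 z).
    - apply (incr_function_le psi1 x z (Derive psi1)); try (simpl; unfold z; lra).
      + intros t Ht1 Ht2. simpl in Ht1. now apply Hd.
      + intros t Ht1 Ht2. apply psi1_Derive_pos; simpl in *; unfold z in *; lra.
    - apply deriv_nonneg_le with (Derive psi1).
      + unfold z; lra.
      + intros t Ht. apply Hd. unfold z in Ht; lra.
      + intros t [Ht1 [Ht2|Ht2]].
        * apply Rlt_le, psi1_Derive_pos; unfold z in Ht1; lra.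
        * rewrite Ht2, psi1_Derive_1. lra. }
  intros Hx Hx1. destruct (Rlt_or_le x 1) as [H|H]; [now apply Hlt|].
  rewrite <- psi1_inv by exact Hx. apply Hlt; [now apply Rinv_0_lt_compat|].
  rewrite <- Rinv_1. apply Rinv_lt_contravar; lra.
Qed.

Theorem theorem3p17 :
  (forall x : R, 0 < x ->
     psi1 x = Rpower x (3 / 4) * (theta2 x * theta3 x * theta4 x) /\
     psi1 x = 2 * Rpower x (3 / 4) * exp (- (PI / 4) * x)
              * infprod (fun k : nat => (1 - exp (- 2 * INR k * PI * x)) ^ 3)) /\
  (forall x : R, 0 < x -> 0 < psi1 x) /\
  (forall y : R, 0 < y ->
     ((forall x : R, 0 < x -> psi1 x <= psi1 y) <-> y = 1)) /\
  smooth_on_Rplus psi1 /\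
  (forall x y : R, 0 < x -> x < y ->
     y * (Derive psi1 y / psi1 y) < x * (Derive psi1 x / psi1 x)) /\
  (forall x : R, 0 < x -> psi1 x = psi1 (1 / x)) /\
  (forall (x : R) (n : nat), 0 < x -> (1 <= n)%nat ->
     Diter n psi1 x = (-1) ^ n * Diter n psi1 (1 / x)).
Proof.
  split; [|split; [|split; [|split; [|split; [|split]]]]].
  - intros x Hx. split; [now apply psi1_theta|].
    rewrite infprod_qpoch by exact Hx. now apply psi1_qpoch.
  - exact psi1_pos.
  - intros y Hy. split.
    + intros H. destruct (Req_dec y 1) as [E|E]; [exact E|].
      assert (Hlt := psi1_lt_max y Hy E). specialize (H 1 Rlt_0_1). lra.
    + intros -> x Hx. destruct (Req_dec x 1) as [->|E]; [apply Rle_refl|].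
      now apply Rlt_le, psi1_lt_max.
  - apply smoothn_smooth, smoothn_psi1.
  - exact psi1_log_derivative_decreasing.
  - intros x Hx. rewrite Rdiv_1_l. symmetry. now apply psi1_inv.
  - intros x n Hx _. rewrite Rdiv_1_l. apply Diter_reflect; [exact smoothn_psi1| |exact Hx].
    intros t Ht. symmetry. now apply psi1_inv.
Qed.
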